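(* Suppose Assumptions 1 and 2 hold. Let $\mathbf X^\star=\mathbf U^\star(\boldsymbol\Lambda^\star)^{1/2}\in\mathbb R^{n\times d}$ and $\hat{\mathbf X}=\mathbf U\boldsymbol\Lambda^{1/2}$ (the $d$-dimensional adjacency spectral embedding of $\mathbf R$). Then, with high probability, $$\min_{\mathbf Q\in\mathbb O_d}\big\|\hat{\mathbf X}-\mathbf X^\star\mathbf Q\big\|_{2,\infty}\le C\sqrt{\frac{d\log T}{\gamma\lambda^\star_d}}\left[1+\kappa\left(\kappa\sqrt{\frac{\log n}{\gamma}}+\sqrt{\frac1T}\right)\|\mathbf R^\star\|_{2,\infty}\right].$$
   Context: Setup. Let $n,T$ be positive integers and $\mathbf Z^\star\in\mathbb R^{n\times T}$ a deterministic real matrix whose $i$-th row $\mathbf Z^\star_i\in\mathbb R^T$ is the $i$-th (true) time series. The observed data are $\mathbf Z=\mathbf Z^\star+\mathbf N$, where $\mathbf N\in\mathbb R^{n\times T}$ is random noise with rows $\mathbf N_1,\dots,\mathbf N_n$. Let $\mathbf M=\mathbf I-\frac1T\mathbf J\in\mathbb R^{T\times T}$ be the centering projection ($\mathbf J$ the all-ones matrix). Define the signal powers $\sigma^{\star2}_i=\frac1T\|\mathbf M\mathbf Z^\star_i\|^2=\frac1T\sum_{t=1}^T(Z^\star_{i,t}-\frac1T\sum_{s}Z^\star_{i,s})^2$, assumed positive for all $i$, and their noisy versions $\hat\sigma_i^2=\frac1T\|\mathbf M\mathbf Z_i\|^2$. Let $\boldsymbol\Sigma^\star=\operatorname{diag}(\sigma^{\star2}_1,\dots,\sigma^{\star2}_n)$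 and $\hat{\boldsymbol\Sigma}=\operatorname{diag}(\hat\sigma^2_1,\dots,\hat\sigma^2_n)$. The true and observed correlation matrices are $\mathbf R^\star=\frac1T(\boldsymbol\Sigma^\star)^{-1/2}\mathbf Z^\star\mathbf M\mathbf Z^{\star\top}(\boldsymbol\Sigma^\star)^{-1/2}$ and $\mathbf R=\frac1T\hat{\boldsymbol\Sigma}^{-1/2}\mathbf Z\mathbf M\mathbf Z^{\top}\hat{\boldsymbol\Sigma}^{-1/2}$. $\mathbf R^\star$ is positive semidefinite; let $d=\operatorname{rank}\mathbf R^\star$, with nonzero eigenvalues $\lambda^\star_1\ge\dots\ge\lambda^\star_d>0$, $\boldsymbol\Lambda^\star=\operatorname{diag}(\lambda^\star_1,\dots,\lambda^\star_d)$, and $\mathbf U^\star\in\mathbb R^{n\times d}$ with orthonormal columns such that $\mathbf R^\star=\mathbf U^\star\boldsymbol\Lambda^\star\mathbf U^{\star\top}$. Let $\kappa=\lambda^\star_1/\lambda^\star_d$. Let $\boldsymbol\Lambda=\operatorname{diag}(\hat\lambda_1,\dots,\hat\lambda_d)$ contain the $d$ largest eigenvalues of $\mathbf R$ and $\mathbf U\in\mathbb R^{n\times d}$ corresponding orthonormal eigenvectors. Assumption 1: the rows $\mathbf N_1,\dots,\mathbf N_n$ are mean zero and independent, $n=O(T)$, and each $\mathbf N_i$ is a $\nu_i$-subgaussian random vector (for every fixed unit vector $\mathbf u\in\mathbb R^T$, $\mathbf u^\top\mathbf N_i$ is $\nu_i$-subgaussian). Define $\gamma=\min_{i\in[n]}\sigma^{\star2}_i/\nu_i$.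 Assumption 2: $\lambda^\star_d$ is bounded away from zero ($\lambda^\star_d=\Omega(1)$), $\kappa=o(T)$, and $\kappa\log T/\gamma=o(1)$. Conventions: asymptotics are as $n,T\to\infty$; $C$ denotes a positive constant not depending on $n,T$; ''with high probability'' means with probability tending to one; $O_P,o_P$ are the usual stochastic order symbols. $\|\cdot\|$ is the spectral norm (Euclidean norm for vectors), $\|\cdot\|_F$ the Frobenius norm, $\|\mathbf B\|_{2,\infty}$ the maximum Euclidean norm of the rows of $\mathbf B$, and $\mathbb O_d$ the set of $d\times d$ orthogonal matrices. *)

(* Defs.v *)
From HB Require Import structures.
From mathcomp Require Import all_boot all_order all_algebra.
From mathcomp Require Import all_classical all_reals all_analysis.
Set Implicit Arguments. Unset Strict Implicit. Unset Printing Implicit Defensive.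
Import Order.TTheory GRing.Theory Num.Theory.
Import numFieldNormedType.Exports.
Local Open Scope classical_set_scope.
Local Open Scope ring_scope.

Section Defs.
Variable R : realType.

Definition centering (T : nat) : 'M[R]_T := 1%:M - (T%:R)^-1 *: const_mx 1.

Definition sigma2 n T (Z : 'M[R]_(n, T)) (i : 'I_n) : R :=
  (T%:R)^-1 * \sum_(t < T) ((row i Z *m centering T) ord0 t) ^+ 2.

Definition corr n T (Z : 'M[R]_(n, T)) : 'M[R]_n :=
  let D := diag_mx (\row_i (Num.sqrt (sigma2 Z i))^-1) in
  (T%:R)^-1 *: (D *m (Z *m centering T *m Z^T) *m D).

Definition norm2inf n m (B : 'M[R]_(n, m)) : R :=
  \big[Num.max/0]_(i < n) Num.sqrt (\sum_(j < m) B i j ^+ 2).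

Definition maxf m (f : 'I_m -> R) : R := \big[Num.max/0]_(i < m) f i.
Definition minf m (f : 'I_m -> R) : R := \big[Num.min/maxf f]_(i < m) f i.

Definition orthonormal_cols n m (U : 'M[R]_(n, m)) : Prop := U^T *m U = 1%:M.
Definition is_orthogonal_mx m (Q : 'M[R]_m) : Prop := Q^T *m Q = 1%:M.

Definition nonincr m (l : 'I_m -> R) : Prop :=
  forall i j : 'I_m, (i <= j)%N -> l j <= l i.

Definition is_nonzero_eigdecomp n m (A : 'M[R]_n) (U : 'M[R]_(n, m))
  (l : 'I_m -> R) : Prop :=
  [/\ orthonormal_cols U, nonincr l, (forall j, 0 < l j) &
      A = U *m diag_mx (\row_j l j) *m U^T].

Definition is_top_eigpairs n m (A : 'M[R]_n) (U : 'M[R]_(n, m))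
  (l : 'I_m -> R) : Prop :=
  exists (V : 'M[R]_n) (w : 'I_n -> R),
    [/\ is_orthogonal_mx V, nonincr w,
        A = V *m diag_mx (\row_j w j) *m V^T &
        forall (j : 'I_m) (j' : 'I_n), val j = val j' ->
          col j U = col j' V /\ l j = w j'].

Definition sqrt_embed n m (U : 'M[R]_(n, m)) (l : 'I_m -> R) : 'M[R]_(n, m) :=
  U *m diag_mx (\row_j Num.sqrt (l j)).

Definition kappa m (l : 'I_m -> R) : R := maxf l / minf l.

Definition gamma n T (Zs : 'M[R]_(n, T)) (nu : 'I_n -> R) : R :=
  minf (fun i => sigma2 Zs i / nu i).

Definition tends_to_infty (u : nat -> nat) : Prop :=
  forall M : nat, exists K : nat, forall k, (K <= k)%N -> (M <= u k)%N.

Section Prob.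
Context {dsp : measure_display} {Om : measurableType dsp}.
Variable P : probability Om R.
Local Open Scope ereal_scope.

Definition subgaussian (X : Om -> R) (nu : R) : Prop :=
  forall s : R, \int[P]_w (expR (s * X w))%:E <= (expR (s ^+ 2 * nu / 2))%:E.

(** mutual independence of the rows N_1,...,N_n (tested on the generating
    pi-system of measurable rectangles) *)
Definition rows_independent n T (N : Om -> 'M[R]_(n, T)) : Prop :=
  forall A : 'I_n -> 'I_T -> set R, (forall i t, measurable (A i t)) ->
    P [set w | forall i t, A i t (N w i t)] =
    \prod_(i < n) P [set w | forall t, A i t (N w i t)].

Definition noise_assumption n T (N : Om -> 'M[R]_(n, T)) (nu : 'I_n -> R) : Prop :=
  [/\ (forall i t, measurable_fun setT (fun w => N w i t)),
      rows_independent N,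
      (forall i t, P.-integrable setT (fun w => (N w i t)%:E) /\
                   \int[P]_w (N w i t)%:E = 0),
      (forall i, (0 < nu i)%R) &
      (forall i (u : 'rV[R]_T), (\sum_(t < T) u ord0 t ^+ 2 = 1)%R ->
         subgaussian (fun w => (u *m (row i (N w))^T) ord0 ord0) (nu i))].
End Prob.

End Defs.

(* Main.v *)
Require Import Defs.
From HB Require Import structures.
From mathcomp Require Import all_boot all_order all_algebra.
From mathcomp Require Import all_classical all_reals all_analysis.
From mathcomp Require Import measurable_realfun ring lra.
Set Implicit Arguments. Unset Strict Implicit. Unset Printing Implicit Defensive.
Import Order.TTheory GRing.Theory Num.Theory.
Import numFieldNormedType.Exports.
Local Open Scope classical_set_scope.
Local Open Scope ring_scope.

(** Let [A] and [W] be the centered signal and noise, both with row [i] divided by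
    [sqrt T] times the signal standard deviation. Then [R* = A A^T] and [R = B B^T]
    with [B = D (A + W)], [D_ii = 1 / |A_i + W_i|]. Write [A = X* Y^T] with [Y^T Y = 1]
    and put [V = B^T U Lambda^(-1/2)], so that [V^T V = 1] and [Xhat = B V]. Since
    [V = Y G + F] with [F = W^T D U Lambda^(-1/2)] of norm
    [eta <= 4 |W| / sqrt lambda*_d],
      [Xhat = D X* H + D W Y G + D W F],   [H = Y^T V],   [H^T H = 1 - F^T (1 - Y Y^T) F].
    Thus [H] is within [2 sqrt d eta^2] of an orthogonal matrix [Q] and only row norms of
    [W Y], which involve the deterministic [Y], have to be controlled entrywise. With high
    probability [|W| = O(1 / sqrt gamma)], by a union bound over a lattice net, and the rows
    of [W Y] are [O(sqrt (d log T / (T gamma)))]. The resulting error is absorbed by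
    the stated bound because [sqrt lambda*_d <= |R*|_(2,oo)], [lambda*_d <= n = O(T)]
    and [1 <= kappa]. *)

(** * Euclidean geometry of row vectors *)

Section EuclideanRows.
Variable R : rcfType.

(** The obstacle is dependence: [U] is a function of all of the noise, so the rows of [W^T] or [W]
    applied to it admit no direct union bound, which is what leave-one-out arguments usually repair.
    Here the exact identity [Xhat = B V] leaves only second-order terms in which [U] meets [W], and
    for these the operator norm of [W] suffices. First-order terms come only from [W Y] and from the
    normalization [D]; the first-order part of [D_ii] is the inner product of the rows [A_i] and
    [W_i], which equals that of [Xs_i] and [(W Y)_i] and so is again a row statistic of [W Y]. A
    cruder estimate by [|W|] would cost [1 / sqrt gamma], too much when the eigenvalues are large.
    The quadratic remainders have size [1 / gamma] and are paid for by the [sqrt (log n / gamma)]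
    term of the bracket. The orthogonal matrix comes from a Cholesky factor instead of a polar
    decomposition; the resulting [sqrt d] is already present in the rate. On the probabilistic side
    everything reduces to finitely many linear forms in the noise with deterministic
    coefficients. *)

Definition dotr n (u v : 'rV[R]_n) : R := (u *m v^T) 0 0.
Definition enorm n (u : 'rV[R]_n) : R := Num.sqrt (dotr u u).

Lemma dotrE n (u v : 'rV[R]_n) : dotr u v = \sum_j u 0 j * v 0 j.
Proof. by rewrite /dotr mxE; apply: eq_bigr => j _; rewrite mxE. Qed.

Lemma dotrC n (u v : 'rV[R]_n) : dotr u v = dotr v u.
Proof. by rewrite !dotrE; apply: eq_bigr => j _; rewrite mulrC. Qed.

Lemma dotrDl n (u v w : 'rV[R]_n) : dotr (u + v) w = dotr u w + dotr v w.
Proof. by rewrite /dotr mulmxDl mxE. Qed.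

Lemma dotrDr n (u v w : 'rV[R]_n) : dotr w (u + v) = dotr w u + dotr w v.
Proof. by rewrite dotrC dotrDl !(dotrC w). Qed.

Lemma dotrZl n a (u w : 'rV[R]_n) : dotr (a *: u) w = a * dotr u w.
Proof. by rewrite /dotr -scalemxAl mxE. Qed.

Lemma dotrZr n a (u w : 'rV[R]_n) : dotr w (a *: u) = a * dotr w u.
Proof. by rewrite dotrC dotrZl dotrC. Qed.

Lemma dotr0 n (u : 'rV[R]_n) : dotr u 0 = 0.
Proof. by rewrite /dotr trmx0 mulmx0 mxE. Qed.

Lemma dotr_mul m n (u : 'rV[R]_m) (M : 'M[R]_(m, n)) v :
  dotr (u *m M) v = dotr u (v *m M^T).
Proof. by rewrite /dotr trmx_mul trmxK mulmxA. Qed.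

Lemma dotrr_sum n (u : 'rV[R]_n) : dotr u u = \sum_j u 0 j ^+ 2.
Proof. by rewrite dotrE; apply: eq_bigr => j _; rewrite expr2. Qed.

Lemma dotrr_ge0 n (u : 'rV[R]_n) : 0 <= dotr u u.
Proof. by rewrite dotrr_sum; apply: sumr_ge0 => j _; exact: sqr_ge0. Qed.

Lemma enorm_ge0 n (u : 'rV[R]_n) : 0 <= enorm u.
Proof. exact: sqrtr_ge0. Qed.

Lemma enorm_sqr n (u : 'rV[R]_n) : enorm u ^+ 2 = dotr u u.
Proof. by rewrite sqr_sqrtr ?dotrr_ge0. Qed.

Lemma dotrr_eq0 n (u : 'rV[R]_n) : (dotr u u == 0) = (u == 0).
Proof.
apply/idP/eqP => [|->]; last by rewrite dotr0.
rewrite dotrr_sum psumr_eq0 => [/allP h|j _]; last exact: sqr_ge0.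
apply/rowP => j; rewrite mxE; apply/eqP.
by have := h j; rewrite mem_index_enum sqrf_eq0 => /(_ isT).
Qed.

Lemma enorm_eq0 n (u : 'rV[R]_n) : (enorm u == 0) = (u == 0).
Proof. by rewrite -dotrr_eq0 -enorm_sqr sqrf_eq0. Qed.

Lemma enorm0 n : enorm (0 : 'rV[R]_n) = 0.
Proof. by apply/eqP; rewrite enorm_eq0. Qed.

Lemma enorm_gt0 n (u : 'rV[R]_n) : (0 < enorm u) = (u != 0).
Proof. by rewrite lt0r enorm_ge0 enorm_eq0 andbT. Qed.

Lemma enormZ n a (u : 'rV[R]_n) : enorm (a *: u) = `|a| * enorm u.
Proof.
by rewrite /enorm dotrZl dotrZr mulrA -expr2 sqrtrM ?sqr_ge0// sqrtr_sqr.
Qed.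

Lemma le_enorm n (u : 'rV[R]_n) a : 0 <= a -> (enorm u <= a) = (dotr u u <= a ^+ 2).
Proof. by move=> a0; rewrite -enorm_sqr ler_sqr ?nnegrE// enorm_ge0. Qed.

Lemma dotr_le n (u v : 'rV[R]_n) : dotr u v <= enorm u * enorm v.
Proof.
have [->|u0] := eqVneq u 0.
  by rewrite dotrC dotr0 enorm0 mul0r.
have [->|v0] := eqVneq v 0; first by rewrite dotr0 enorm0 mulr0.
have ug : 0 < enorm u by rewrite enorm_gt0.
have vg : 0 < enorm v by rewrite enorm_gt0.
have := dotrr_ge0 (enorm v *: u - enorm u *: v).
rewrite -[- (_ *: v)]scaleNr !(dotrDl, dotrDr, dotrZl, dotrZr) -!enorm_sqr (dotrC v u).
move: (dotr u v) => c h.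
rewrite -subr_ge0 -(pmulr_rge0 _ (mulr_gt0 ug vg)).
nra.
Qed.

Lemma normr_dotr_le n (u v : 'rV[R]_n) : `|dotr u v| <= enorm u * enorm v.
Proof.
rewrite ler_norml dotr_le andbT lerNl.
have := dotr_le (- u) v; rewrite -scaleN1r dotrZl enormZ normrN1 mul1r.
by rewrite mulN1r.
Qed.

Lemma enormD n (u v : 'rV[R]_n) : enorm (u + v) <= enorm u + enorm v.
Proof.
rewrite le_enorm ?addr_ge0 ?enorm_ge0//.
rewrite !(dotrDl, dotrDr) sqrrD -!enorm_sqr (dotrC v u).
have := dotr_le u v; lra.
Qed.

Lemma enormN n (u : 'rV[R]_n) : enorm (- u) = enorm u.
Proof. by rewrite -scaleN1r enormZ normrN1 mul1r. Qed.

Lemma enormB n (u v : 'rV[R]_n) : enorm (u - v) <= enorm u + enorm v.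
Proof. by rewrite -(enormN v) enormD. Qed.

(* [M] acts on row vectors, i.e. on the right, so this bounds the spectral norm of [M^T]. *)
Definition opb m n (M : 'M[R]_(m, n)) (b : R) :=
  forall u : 'rV_m, enorm (u *m M) <= b * enorm u.

Lemma opb_mul m n p (M : 'M[R]_(m, n)) (N : 'M[R]_(n, p)) a b : 0 <= b ->
  opb M a -> opb N b -> opb (M *m N) (b * a).
Proof.
move=> b0 ha hb u; rewrite mulmxA (le_trans (hb _))// -mulrA.
exact: ler_wpM2l (ha u).
Qed.

Lemma opbD m n (M N : 'M[R]_(m, n)) a b :
  opb M a -> opb N b -> opb (M + N) (a + b).
Proof.
by move=> ha hb u; rewrite mulmxDr mulrDl (le_trans (enormD _ _))// lerD.
Qed.

Lemma opbN m n (M : 'M[R]_(m, n)) a : opb M a -> opb (- M) a.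
Proof. by move=> ha u; rewrite mulmxN enormN. Qed.

Lemma opb_le m n (M : 'M[R]_(m, n)) a b : a <= b -> opb M a -> opb M b.
Proof. by move=> ab ha u; apply: le_trans (ha u) _; rewrite ler_wpM2r// enorm_ge0. Qed.

Lemma opb_tr m n (M : 'M[R]_(m, n)) b : 0 <= b -> opb M b -> opb M^T b.
Proof.
move=> b0 hb u.
have [->|] := eqVneq (enorm (u *m M^T)) 0; first by rewrite mulr_ge0 ?enorm_ge0.
rewrite neq_lt ltNge enorm_ge0/= => h.
rewrite -(ler_pM2l h) -expr2 enorm_sqr dotr_mul trmxK (le_trans (dotr_le _ _))//.
rewrite mulrC (le_trans (ler_wpM2r (enorm_ge0 _) (hb _)))//.
by rewrite -mulrA mulrCA.
Qed.

Lemma enorm_iso m n (M : 'M[R]_(m, n)) u : M *m M^T = 1%:M ->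
  enorm (u *m M) = enorm u.
Proof. by move=> h; rewrite /enorm dotr_mul -mulmxA h mulmx1. Qed.

Lemma opb_iso m n (M : 'M[R]_(m, n)) : M *m M^T = 1%:M -> opb M 1.
Proof. by move=> h u; rewrite enorm_iso// mul1r. Qed.

Lemma opb_diag n (D : 'I_n -> R) b : 0 <= b -> (forall i, `|D i| <= b) ->
  opb (diag_mx (\row_i D i)) b.
Proof.
move=> b0 h u; rewrite le_enorm ?mulr_ge0 ?enorm_ge0// exprMn enorm_sqr.
rewrite !dotrr_sum mulr_sumr; apply: ler_sum => j _.
rewrite mul_mx_diag !mxE exprMn mulrC ler_wpM2r ?sqr_ge0//.
by rewrite -ler_sqrt ?exprn_ge0// !sqrtr_sqr (ger0_norm b0).
Qed.

Lemma enorm_delta n (i : 'I_n) : enorm (delta_mx 0 i : 'rV[R]_n) = 1.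
Proof.
rewrite /enorm dotrr_sum (bigD1 i)//= !mxE !eqxx big1 ?addr0 ?expr1n ?sqrtr1//.
by move=> j /negPf ji; rewrite !mxE ji andbF expr0n.
Qed.

Lemma enorm_row_le n p (M : 'M[R]_(n, p)) b i : opb M b -> enorm (row i M) <= b.
Proof. by move=> h; rewrite rowE (le_trans (h _))// enorm_delta mulr1. Qed.

Definition fro2 m n (M : 'M[R]_(m, n)) : R := \sum_i \sum_j M i j ^+ 2.

Lemma fro2_rows m n (M : 'M[R]_(m, n)) : fro2 M = \sum_i dotr (row i M) (row i M).
Proof.
by apply: eq_bigr => i _; rewrite dotrr_sum; apply: eq_bigr => j _; rewrite mxE.
Qed.

Lemma fro2_ge0 m n (M : 'M[R]_(m, n)) : 0 <= fro2 M.
Proof. by apply: sumr_ge0 => i _; apply: sumr_ge0 => j _; exact: sqr_ge0. Qed.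

Lemma fro2_opb m n (M : 'M[R]_(m, n)) b : 0 <= b -> opb M b -> fro2 M <= m%:R * b ^+ 2.
Proof.
move=> b0 h; rewrite fro2_rows mulr_natl -[X in _ *+ X](card_ord m) -sumr_const.
by apply: ler_sum => i _; rewrite -le_enorm// enorm_row_le.
Qed.

Lemma opb_fro m n (M : 'M[R]_(m, n)) : opb M (Num.sqrt (fro2 M)).
Proof.
suff h : opb M^T (Num.sqrt (fro2 M)) by have := opb_tr (sqrtr_ge0 _) h; rewrite trmxK.
move=> u; rewrite le_enorm ?mulr_ge0 ?enorm_ge0 ?sqrtr_ge0// exprMn sqr_sqrtr ?fro2_ge0//.
rewrite dotrr_sum fro2_rows mulr_suml; apply: ler_sum => i _.
have -> : (u *m M^T) 0 i = dotr u (row i M).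
  by rewrite mxE dotrE; apply: eq_bigr => j _; rewrite !mxE.
rewrite -real_normK ?num_real// -!enorm_sqr mulrC -exprMn.
by rewrite ler_sqr ?nnegrE ?mulr_ge0 ?enorm_ge0// normr_dotr_le.
Qed.

End EuclideanRows.

(** * Cholesky factorization and distance to the orthogonal group *)

Section Cholesky.
Variable R : rcfType.

(** Induction on the dimension: split off the pivot [a] and recurse on the Schur complement [C'].
    The inverse [M] is built alongside [L] because its triangularity is needed later. *)
Lemma cholesky n (S : 'M[R]_n) : S^T = S ->
  (forall x : 'rV_n, x != 0 -> 0 < dotr (x *m S) x) ->
  exists L M : 'M[R]_n, [/\ is_trig_mx L, is_trig_mx M, L *m M = 1%:M,
     (forall i, 0 < L i i) & S = L *m L^T].
Proof.
elim: n S => [|n IH] S sS pS.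
  exists 0, 0; split; try by apply/is_trig_mxP => -[].
  - by apply/matrixP => -[].
  - by case.
  - by apply/matrixP => -[].
pose S0 : 'M[R]_(1 + n) := S.
pose a := S 0 0.
pose b : 'cV_n := dlsubmx S0.
pose C := drsubmx S0.
have a0 : 0 < a.
  have := pS (delta_mx 0 0); rewrite -enorm_gt0 enorm_delta => /(_ ltr01).
  rewrite -rowE dotrC dotrE (bigD1 0)//= big1 ?addr0; last first.
    by move=> j j0; rewrite !mxE eqxx (negPf j0) mul0r.
  by rewrite !mxE !eqxx mul1r.
have eS : S = block_mx a%:M b^T b C :> 'M[R]_(1 + n).
  rewrite -[LHS](@submxK _ 1 n 1 n); congr block_mx.
    by apply/matrixP => i j; rewrite !ord1 !mxE; congr (S _ _); apply/val_inj.
  apply/matrixP => i j; rewrite !mxE.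
  by have /matrixP/(_ (lshift n i) (rshift 1 j)) := sS; rewrite mxE.
have sC : C^T = C.
  apply/matrixP => i j; rewrite !mxE.
  by have /matrixP/(_ (rshift 1 i) (rshift 1 j)) := sS; rewrite mxE.
pose C' := C - a^-1 *: (b *m b^T).
have [||L [M [tL tM LM Lg eC]]] := IH C'.
- by rewrite /C' linearB/= linearZ/= trmx_mul trmxK sC.
- move=> x x0.
  (* For fixed [x], this first coordinate minimizes the quadratic form of [S], and the minimum is
     the form of the Schur complement at [x]. *)
  pose y : 'rV_(1 + n) := row_mx (- a^-1 *: (x *m b)) x.
  have y0 : y != 0.
    apply: contra x0 => /eqP; rewrite -[0](@row_mx0 _ 1 1 n) => /eq_row_mx[_ ->].
    by [].
  have := pS y y0; congr (_ < _).
  rewrite eS /dotr /y (@mul_row_block _ 1 1 n 1 n) (@tr_row_mx _ 1 1 n) (@mul_row_col _ 1 1 n 1).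
  rewrite mul_mx_scalar scalerA mulrN divff ?gt_eqF// scaleN1r addNr mul0mx add0r.
  by rewrite /C' mulmxBr -scalemxAl addrC -scalemxAr mulmxA scaleNr.
have sa : Num.sqrt a != 0 by rewrite sqrtr_eq0 -ltNge.
exists (block_mx (Num.sqrt a)%:M 0 ((Num.sqrt a)^-1 *: b) L : 'M[R]_(1 + n)).
exists (block_mx (Num.sqrt a)^-1%:M 0 (- a^-1 *: (M *m b)) M : 'M[R]_(1 + n)).
have trig (s : R) (c : 'cV_n) (N : 'M[R]_n) : is_trig_mx N ->
    is_trig_mx (block_mx s%:M 0 c N : 'M[R]_(1 + n)).
  move=> tN; apply/is_trig_mxP => i j.
  rewrite -(fintype.splitK i) -(fintype.splitK j).
  case: (fintype.split i) => i'; case: (fintype.split j) => j' /=.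
  - by rewrite !ord1.
  - by rewrite block_mxEur mxE.
  - by rewrite !ord1.
  - by rewrite block_mxEdr !/bump/= ltnS => ?; move/is_trig_mxP: tN; apply.
split.
- exact: trig.
- exact: trig.
- rewrite (@mulmx_block _ 1 n 1 n 1 n) !mulmx0 !mul0mx !addr0 add0r -scalar_mxM divff//.
  rewrite LM mul_mx_scalar scalerA -scalemxAr mulmxA LM mul1mx -scalerDl.
  rewrite -expr2 exprVn sqr_sqrtr ?ltW// subrr scale0r.
  by rewrite -(@scalar_mx_block _ 1 n).
- move=> i; rewrite -(@fintype.splitK 1 n i); case: (@fintype.split 1 n i) => i' /=.
    by rewrite (@block_mxEul _ 1 n 1 n) !ord1 mxE eqxx mulr1n lt0r sa sqrtr_ge0.
  by rewrite (@block_mxEdr _ 1 n 1 n).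
- rewrite eS (@tr_block_mx _ 1 n 1 n) (@mulmx_block _ 1 n 1 n 1 n).
  rewrite trmx0 !mulmx0 !mul0mx !addr0 tr_scalar_mx -scalar_mxM -expr2 sqr_sqrtr ?ltW//.
  rewrite mul_scalar_mx mul_mx_scalar linearZ/= !scalerA divff// !scale1r.
  apply: (congr1 (@block_mx _ 1 n 1 n a%:M b^T b)).
  rewrite -eC /C' -scalemxAl -scalemxAr scalerA -expr2 exprVn sqr_sqrtr ?ltW//.
  by rewrite addrC subrK.
Qed.

End Cholesky.

Section NearOrthogonal.
Variable R : rcfType.

(* With the Cholesky factorization [H^T H = L L^T] and [Q = H L^-T] one has
   [H - Q = Q (L^T - 1)]; since [L - L^-T = (L L^T - 1) L^-T], where [L] is lower
   and [L^-T] upper triangular, [L - 1] is dominated entrywise by [(L L^T - 1) L^-T]. *)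
Lemma near_orthogonal d (H : 'M[R]_d) (e : R) : 0 <= e -> e <= 3 / 4 ->
  opb (H^T *m H - 1%:M) e ->
  exists Q : 'M[R]_d, Q^T *m Q = 1%:M /\
    forall x : 'rV_d, enorm (x *m (H - Q)) <= 2 * Num.sqrt d%:R * e * enorm x.
Proof.
move=> e0 e34 he.
pose S := H^T *m H.
have sS : S^T = S by rewrite /S trmx_mul trmxK.
have lS (x : 'rV_d) : (1 - e) * dotr x x <= dotr (x *m S) x.
  have -> : S = (S - 1%:M) + 1%:M by rewrite subrK.
  rewrite mulmxDr mulmx1 dotrDl.
  have : - (e * dotr x x) <= dotr (x *m (S - 1%:M)) x.
    have := normr_dotr_le (x *m (S - 1%:M)) x; rewrite ler_norml => /andP[h _].
    apply: le_trans h; rewrite lerN2 -enorm_sqr expr2 mulrA.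
    by rewrite ler_wpM2r ?enorm_ge0 ?he.
  by rewrite mulrBl mul1r; lra.
have pS (x : 'rV_d) : x != 0 -> 0 < dotr (x *m S) x.
  move=> x0; apply: lt_le_trans (lS x).
  have : 0 < dotr x x by rewrite -enorm_sqr exprn_gt0// enorm_gt0.
  by move=> ?; rewrite mulr_gt0//; lra.
have [L [M [tL tM LM Lg eS]]] := cholesky sS pS.
have ML : M *m L = 1%:M by apply: mulmx1C.
have LMT : M^T *m L^T = 1%:M by rewrite -trmx_mul LM trmx1.
have MLT : L^T *m M^T = 1%:M by rewrite -trmx_mul ML trmx1.
(* Here [e <= 3/4] enters: [S] dominates [1/4], so a quarter of [|x M|^2] is at most
   [|x M L|^2 = |x|^2]. *)
have oM : opb M 2.
  move=> x; have := lS (x *m M).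
  rewrite eS mulmxA [X in _ <= X]dotr_mul trmxK -[x *m M *m L]mulmxA ML mulmx1 -!enorm_sqr => h.
  rewrite -ler_sqr ?nnegrE ?mulr_ge0 ?enorm_ge0//.
  have := sqr_ge0 (enorm (x *m M)); move: h; set t := _ ^+ 2 => h t0.
  by rewrite exprMn; nra.
have oMT : opb M^T 2 by apply: opb_tr.
pose Q := H *m M^T.
have QQ : Q^T *m Q = 1%:M.
  by rewrite /Q trmx_mul trmxK mulmxA -(mulmxA M) -/S eS mulmxA ML mul1mx.
have HQ : H = Q *m L^T by rewrite /Q -mulmxA LMT mulmx1.
have QQ' : Q *m Q^T = 1%:M by apply: mulmx1C.
pose D := (S - 1%:M) *m M^T.
have eD : L - M^T = D by rewrite /D mulmxBl eS mul1mx -mulmxA MLT mulmx1.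
have LM1 i : L i i * M i i = 1.
  have /matrixP/(_ i i) := LM; rewrite !mxE eqxx (bigD1 i)//= big1 ?addr0//.
  move=> k ki; have [lt|] := ltnP i k.
    by move/is_trig_mxP: tL => ->; rewrite ?mul0r.
  rewrite leq_eqVlt => /orP[/eqP/val_inj eki|lt]; first by rewrite eki eqxx in ki.
  by move/is_trig_mxP: tM => ->; rewrite ?mulr0.
have fL : fro2 (L - 1%:M) <= fro2 D.
  apply: ler_sum => i _; apply: ler_sum => j _.
  rewrite -eD !mxE.
  have [lt|lt|/val_inj ->] := ltngtP i j.
  - have /is_trig_mxP -> := tL => //.
    by rewrite (ltn_eqF lt : (i == j) = false) subrr expr0n sqr_ge0.
  - have /is_trig_mxP -> := tM => //.
    by rewrite (gtn_eqF lt : (i == j) = false).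
  (* On the diagonal [m = 1/l], and [|l - 1/l| = |l - 1| (1 + 1/l)] dominates [|l - 1|]. Below the
     diagonal the two entries coincide, above it the left one is zero. *)
  - rewrite eqxx/=; have l0 := Lg j; have lm := LM1 j.
    have m0 : 0 < M j j by rewrite -(pmulr_rgt0 _ l0) lm.
    rewrite -subr_ge0 subr_sqr.
    set l := L j j in l0 lm *; set m := M j j in m0 lm *.
    have -> : (l - m - (l - 1)) * (l - m + (l - 1)) =
      (m - 1) ^+ 2 * (1 + 2 * l) + (1 - l * m) * (2 * m - 2).
      by ring.
    rewrite lm subrr mul0r addr0 mulr_ge0 ?sqr_ge0//; lra.
exists Q; split=> // x.
rewrite HQ -{2}[Q]mulmx1 -mulmxBr mulmxA -trmx1 -linearB/=.
have := opb_tr (sqrtr_ge0 _) (opb_fro (L - 1%:M)) => /(_ (x *m Q))/le_trans; apply.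
rewrite enorm_iso// ler_wpM2r ?enorm_ge0//.
have oD : opb D (2 * e) by apply: opb_mul.
have := le_trans fL (fro2_opb _ oD); rewrite mulr_ge0// => /(_ isT) h.
have -> : 2 * Num.sqrt d%:R * e = Num.sqrt (d%:R * (2 * e) ^+ 2).
  by rewrite sqrtrM// sqrtr_sqr ger0_norm ?mulr_ge0//; ring.
by rewrite ler_wsqrtr.
Qed.

End NearOrthogonal.

(** * Perturbation of the embedding *)

Definition diagf (R : realType) n (f : 'I_n -> R) : 'M[R]_n := diag_mx (\row_j f j).

Section Deterministic.
Variable R : realType.

Lemma diagf_mul n (f g : 'I_n -> R) : diagf f *m diagf g = diagf (fun j => f j * g j).
Proof. by rewrite /diagf mulmx_diag; congr diag_mx; apply/rowP => j; rewrite !mxE. Qed.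

Lemma diagf1 n (f : 'I_n -> R) : (forall j, f j = 1) -> diagf f = 1%:M.
Proof. by move=> h; apply/matrixP => i j; rewrite !mxE h. Qed.

Lemma tr_diagf n (f : 'I_n -> R) : (diagf f)^T = diagf f.
Proof. exact: tr_diag_mx. Qed.

Lemma row_diagf n m (f : 'I_n -> R) (M : 'M[R]_(n, m)) i : row i (diagf f *m M) = f i *: row i M.
Proof. by apply/rowP => j; rewrite /diagf mul_diag_mx !mxE. Qed.

Lemma mulmx_tr_eq0 n m (M : 'M[R]_(n, m)) : M *m M^T = 0 -> M = 0.
Proof.
move=> h; apply/row_matrixP => i; rewrite row0; apply/eqP; rewrite -dotrr_eq0.
have /matrixP/(_ i i) := h; rewrite [RHS]mxE => <-.
by rewrite dotrE mxE; apply/eqP/eq_bigr => j _; rewrite !mxE.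
Qed.

Lemma dotr_diagf n (f : 'I_n -> R) (z : 'rV_n) :
  dotr (z *m diagf f) z = \sum_j f j * z 0 j ^+ 2.
Proof.
rewrite dotrE; apply: eq_bigr => j _.
by rewrite /diagf mul_mx_diag !mxE expr2; ring.
Qed.

Lemma orthonormal_cols_le n d (U : 'M[R]_(n, d)) : orthonormal_cols U -> (d <= n)%N.
Proof.
move=> h; have := mxrankM_maxr U^T U; rewrite h mxrank1 => /leq_trans; apply.
exact: rank_leq_row.
Qed.

Lemma norm2inf_le n m (M : 'M[R]_(n, m)) c : 0 <= c ->
  (forall i, enorm (row i M) <= c) -> norm2inf M <= c.
Proof.
move=> c0 h; apply: bigmax_le => // i _; apply: le_trans (h i).
rewrite /enorm dotrr_sum le_eqVlt; apply/orP; left; apply/eqP; congr Num.sqrt.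
by apply: eq_bigr => j _; rewrite mxE.
Qed.

Lemma top_eigpairs_eq n d (A : 'M[R]_n) (U : 'M[R]_(n, d)) l : (d <= n)%N ->
  is_top_eigpairs A U l -> U^T *m U = 1%:M /\ A *m U = U *m diagf l.
Proof.
move=> dn [V [w [oV _ eA h]]].
pose f := widen_ord dn.
have hU i j : U i j = V i (f j).
  by have [/colP/(_ i) + _] := h j (f j) erefl; rewrite !mxE.
have hl j : l j = w (f j) by have [_] := h j (f j) erefl.
have AV : A *m V = V *m diagf w by rewrite eA -mulmxA oV mulmx1.
split; apply/matrixP => i j.
  have /matrixP/(_ (f i) (f j)) := oV; rewrite !mxE => <-.
  by apply: eq_bigr => k _; rewrite !mxE !hU.
have /matrixP/(_ i (f j)) := AV; rewrite /diagf !mul_mx_diag !mxE hl hU => <-.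
by apply: eq_bigr => k _; rewrite hU.
Qed.

(** * Right singular vectors of the normalized signal *)

Section RightFactor.
Variables (n T d : nat) (A : 'M[R]_(n, T)) (Us : 'M[R]_(n, d)) (ls : 'I_d -> R).
Hypothesis hA : is_nonzero_eigdecomp (A *m A^T) Us ls.

Definition right_factor : 'M[R]_(T, d) :=
  A^T *m Us *m diag_mx (\row_j (Num.sqrt (ls j))^-1).
Let Y := right_factor.
Let Xs := sqrt_embed Us ls.

Lemma right_factor_ortho : Y^T *m Y = 1%:M.
Proof.
have [oU _ lp eA] := hA.
rewrite /Y /right_factor !trmx_mul trmxK -/(diagf _) tr_diagf -!mulmxA (mulmxA A) eA !mulmxA.
rewrite -(mulmxA _ Us^T Us) oU mulmx1 -(mulmxA _ Us^T Us) oU mulmx1 !diagf_mul diagf1// => j.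
have := lp j; move=> lj; rewrite -{2}(sqr_sqrtr (ltW lj)).
have : Num.sqrt (ls j) != 0 by rewrite sqrtr_eq0 -ltNge.
by move=> ?; field.
Qed.

(** The product collapses to [Us Us^T A], and [(1 - Us Us^T) A] vanishes because its Gram matrix
    does. *)
Lemma embed_right_factor : Xs *m Y^T = A.
Proof.
have [oU _ lp eA] := hA.
have -> : Xs *m Y^T = Us *m Us^T *m A.
  rewrite /Xs /sqrt_embed /Y /right_factor !trmx_mul trmxK -/(diagf _) -/(diagf _) tr_diagf.
  rewrite !mulmxA -(mulmxA Us) diagf_mul diagf1 ?mulmx1// => j.
  by rewrite divff// sqrtr_eq0 -ltNge.
apply/esym/eqP; rewrite -subr_eq0; apply/eqP/mulmx_tr_eq0.
have -> : A - Us *m Us^T *m A = (1%:M - Us *m Us^T) *m A by rewrite mulmxBl mul1mx.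
rewrite trmx_mul mulmxA -(mulmxA _ A) eA.
by rewrite !mulmxA mulmxBl mul1mx -(mulmxA Us) oU mulmx1 subrr !mul0mx.
Qed.

Lemma row_embed_enorm i : enorm (row i A) = 1 -> enorm (row i Xs) = 1.
Proof.
move=> <-; have := @enorm_iso _ _ _ Y^T (row i Xs); rewrite -row_mul embed_right_factor => -> //.
by rewrite trmxK right_factor_ortho.
Qed.

End RightFactor.

(** * Row-wise error for a given diagonal normalization *)

Section Perturbation.
Variables (n T d : nat) (A W : 'M[R]_(n, T)) (Us : 'M[R]_(n, d)) (ls : 'I_d -> R).
Hypothesis hA : is_nonzero_eigdecomp (A *m A^T) Us ls.
Variables (lam a b : R) (D : 'I_n -> R).
Hypotheses (lam0 : 0 < lam) (hlam : forall j, lam <= ls j).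
Hypotheses (b0 : 0 <= b) (hW : opb W b) (blam : 16 * b <= Num.sqrt lam).
Hypotheses (D0 : forall i, 0 < D i) (D2 : forall i, D i <= 2)
  (Dinv : forall i, (D i)^-1 <= 5 / 4).
Let B := diagf D *m (A + W).
Variables (U : 'M[R]_(n, d)) (l : 'I_d -> R).
Hypothesis hU : is_top_eigpairs (B *m B^T) U l.
Let Y := right_factor A Us ls.
Let Xs := sqrt_embed Us ls.

(* Courant-Fischer, tested on the range of [D^-1 Us]. *)
Lemma top_eigenvalue_ge j : lam / 4 <= l j.
Proof.
have [oU _ lp eA] := hA.
have dn := orthonormal_cols_le oU.
have [V [w [oV nw eB h]]] := hU.
rewrite leNgt; apply/negP => lj.
have jn : (j <= n)%N by rewrite (leq_trans _ dn)// ltnW.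
(* The [d] free coordinates of [y] face only [j < d] conditions, namely that [x] be orthogonal to
   the first [j] eigenvectors. The factor [D^-1] in [x] cancels the [D] in [B]. *)
pose K : 'M[R]_(d, j) :=
  \matrix_(i, c) (Us^T *m diagf (fun i => (D i)^-1) *m V) i (widen_ord jn c).
have : kermx K != 0.
  by rewrite -mxrank_eq0 mxrank_ker subn_eq0 -ltnNge (leq_ltn_trans (rank_leq_col _)).
case/rowV0Pn => y /sub_kermxP yK y0.
pose x := y *m Us^T *m diagf (fun i => (D i)^-1).
pose z := x *m V.
have z0 (c : 'I_n) : (c < j)%N -> z 0 c = 0.
  move=> cj; have /rowP/(_ (Ordinal cj)) := yK; rewrite [RHS]mxE => <-.
  have -> : z = y *m (Us^T *m diagf (fun i => (D i)^-1) *m V) by rewrite /z /x !mulmxA.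
  rewrite !mxE; apply: eq_bigr => i _; congr (_ * _).
  by rewrite [RHS]mxE; congr (_ _ _); apply/val_inj.
have VV : V *m V^T = 1%:M by apply: mulmx1C.
have xB : dotr (x *m B) (x *m B) <= lam / 4 * dotr x x.
  rewrite dotr_mul -[X in X <= _]dotrC -mulmxA eB !mulmxA dotr_mul trmxK.
  rewrite -/z dotr_diagf -(enorm_sqr x) -(enorm_iso x VV) enorm_sqr -/z dotrr_sum mulr_sumr.
  apply: ler_sum => c _; have [cj|jc] := ltnP c j; first by rewrite z0// expr0n !mulr0.
  rewrite ler_wpM2r ?sqr_ge0//; apply: le_trans (ltW lj).
  have [_ ->] := h j (widen_ord dn j) erefl.
  exact: nw.
have exB : x *m B = y *m Us^T *m A + y *m Us^T *m W.
  rewrite /x /B mulmxA -(mulmxA _ (diagf _) (diagf _)) diagf_mul diagf1 ?mulmx1 ?mulmxDr// => i.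
  by rewrite mulVf// gt_eqF.
have yU : enorm (y *m Us^T) = enorm y by rewrite enorm_iso// trmxK.
have yA : Num.sqrt lam * enorm y <= enorm (y *m Us^T *m A).
  rewrite -ler_sqr ?nnegrE ?mulr_ge0 ?enorm_ge0 ?sqrtr_ge0//.
  rewrite exprMn (sqr_sqrtr (ltW lam0)) !enorm_sqr [X in _ <= X]dotr_mul.
  rewrite [X in _ <= X]dotrC -(mulmxA _ A A^T) eA !mulmxA.
  rewrite -(mulmxA y) oU mulmx1 dotr_mul trmxK -(mulmxA y) oU mulmx1 dotr_diagf.
  by rewrite dotrr_sum mulr_sumr; apply: ler_sum => i _; rewrite ler_wpM2r ?sqr_ge0.
have yW : enorm (y *m Us^T *m W) <= b * enorm y by rewrite -yU.
have xy : enorm x <= 5 / 4 * enorm y.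
  rewrite -yU; apply: opb_diag => // i; rewrite ger0_norm// ltW// invr_gt0//.
have Ey : 0 < enorm y by rewrite enorm_gt0.
have sl : 0 < Num.sqrt lam by rewrite sqrtr_gt0.
(* The contradiction is [15/16] against [5/8]: the signal gives [sqrt lam] minus noise of at most
   [sqrt lam / 16], while the assumed small eigenvalue gives at most [sqrt (lam / 4)] times
   [|x| <= 5/4 |y|]. *)
have l1 : 15 / 16 * (Num.sqrt lam * enorm y) <= enorm (x *m B).
  rewrite exB.
  have := enormB (y *m Us^T *m A + y *m Us^T *m W) (y *m Us^T *m W); rewrite addrK.
  have : b * enorm y <= 1 / 16 * (Num.sqrt lam * enorm y).
    by rewrite mulrA ler_wpM2r ?enorm_ge0//; have := blam; lra.
  lra.
have l2 : enorm (x *m B) <= 5 / 8 * (Num.sqrt lam * enorm y).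
  rewrite le_enorm ?mulr_ge0 ?enorm_ge0 ?sqrtr_ge0//.
  apply: (le_trans xB).
  have : dotr x x <= (5 / 4 * enorm y) ^+ 2 by rewrite -le_enorm// mulr_ge0 ?enorm_ge0.
  move=> h0; have -> : (5 / 8 * (Num.sqrt lam * enorm y)) ^+ 2 = lam / 4 * (5 / 4 * enorm y) ^+ 2.
    by rewrite -{2}(sqr_sqrtr (ltW lam0)); field.
  by rewrite ler_wpM2l// divr_ge0// ltW.
have := mulr_gt0 sl Ey; lra.
Qed.

Hypotheses (a0 : 0 <= a) (rA : forall i, enorm (row i A) = 1)
  (hWY : forall i, enorm (row i W *m Y) <= a).
Variable e : R.
Hypothesis e0 : 0 <= e.
Hypothesis De : forall i, `|D i - 1| <= e.

Lemma embedding_perturbation_diag : exists Q : 'M[R]_d, is_orthogonal_mx Q /\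
  norm2inf (sqrt_embed U l - Xs *m Q) <=
    e + 32 * Num.sqrt d%:R * (b ^+ 2 / lam) + 4 * a + 8 * (b ^+ 2 / Num.sqrt lam).
Proof.
have [oUs _ lp eA] := hA.
have dn := orthonormal_cols_le oUs.
have [oU RU] := top_eigpairs_eq dn hU.
have lge := top_eigenvalue_ge.
have sl : 0 < Num.sqrt lam by rewrite sqrtr_gt0.
have sl2 : Num.sqrt lam ^+ 2 = lam by rewrite sqr_sqrtr// ltW.
have lpos j : 0 < l j by apply: lt_le_trans (lge j); rewrite divr_gt0.
have YY : Y^T *m Y = 1%:M := right_factor_ortho hA.
have eXY : Xs *m Y^T = A := embed_right_factor hA.
pose il := diagf (fun j => (Num.sqrt (l j))^-1).
pose Vh := B^T *m U *m il.
pose F := W^T *m diagf D *m U *m il.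
pose G := Xs^T *m diagf D *m U *m il.
have slN0 j : Num.sqrt (l j) != 0 by rewrite sqrtr_eq0 -ltNge.
have BVh : B *m Vh = sqrt_embed U l.
  rewrite /Vh !mulmxA RU -mulmxA diagf_mul /sqrt_embed -/(diagf _); congr (_ *m diagf _).
  by apply/funext => j; rewrite -{1}(sqr_sqrtr (ltW (lpos j))) expr2 mulfK.
have VV : Vh^T *m Vh = 1%:M.
  have -> : Vh^T = il *m U^T *m B.
    by rewrite /Vh (trmx_mul _ il) (trmx_mul _ U) trmxK tr_diagf mulmxA.
  rewrite -mulmxA BVh /sqrt_embed -/(diagf _)
    -mulmxA (mulmxA U^T) oU mul1mx diagf_mul diagf1// => j.
  by rewrite mulVf.
have VhE : Vh = Y *m G + F.
  have YX : Y *m Xs^T = A^T by rewrite -eXY (trmx_mul Xs Y^T) trmxK.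
  have BT : B^T = (A^T + W^T) *m diagf D by rewrite trmx_mul tr_diagf linearD.
  by rewrite /Vh /G /F !mulmxA YX BT !mulmxDl.
pose H := Y^T *m Vh.
have GE : G = H - Y^T *m F by rewrite /H VhE mulmxDr mulmxA YY mul1mx addrK.
pose eta := 4 * b / Num.sqrt lam.
have eta0 : 0 <= eta by rewrite /eta divr_ge0 ?mulr_ge0// ltW.
have eta4 : eta <= 1 / 4 by have := blam; rewrite /eta ler_pdivrMr//; lra.
have oF : opb F eta.
  have h1 : opb W^T b by apply: opb_tr.
  have h2 : opb (diagf D) 2 by apply: opb_diag => // i; rewrite gtr0_norm.
  have h3 : opb U 1.
    by rewrite -[U]trmxK; apply: opb_tr => //; apply: opb_iso; rewrite trmxK.
  have h4 : opb il (2 / Num.sqrt lam).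
    apply: opb_diag => [|i]; first by rewrite divr_ge0// ltW.
    have h : Num.sqrt lam / 2 <= Num.sqrt (l i).
      have -> : Num.sqrt lam / 2 = Num.sqrt (lam / 4).
        have -> : lam / 4 = (Num.sqrt lam / 2) ^+ 2 by rewrite expr_div_n sl2; field.
        by rewrite sqrtr_sqr ger0_norm// divr_ge0// ltW.
      by rewrite ler_wsqrtr.
    rewrite ger0_norm ?invr_ge0 ?sqrtr_ge0//.
    rewrite -[leRHS]invrK lef_pV2 ?posrE ?invr_gt0 ?divr_gt0//.
      by rewrite invf_div.
    by rewrite sqrtr_gt0.
  have <- : 2 / Num.sqrt lam * (1 * (2 * b)) = eta by rewrite /eta; field; rewrite gt_eqF.
  by do 3![apply: opb_mul => //]; rewrite divr_ge0// ltW.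
have oYt : opb Y^T 1 by apply: opb_iso; rewrite trmxK.
have oVh : opb Vh 1.
  by rewrite -[Vh]trmxK; apply: opb_tr => //; apply: opb_iso; rewrite trmxK.
have oH : opb H 1 by rewrite -[1]mul1r; apply: opb_mul.
have oG : opb G 2.
  rewrite GE; apply: (@opb_le _ _ _ _ (1 + eta * 1)); first lra.
  by apply: opbD => //; apply: opbN; apply: opb_mul.
pose P := 1%:M - Y *m Y^T.
have Psym : P^T = P by rewrite /P linearB/= trmx1 trmx_mul trmxK.
have PY : P *m Y = 0 by rewrite /P mulmxBl mul1mx -mulmxA YY mulmx1 subrr.
have PP : P *m P = P.
  by rewrite {2}/P mulmxBr mulmx1 mulmxA PY mul0mx subr0.
have PVh : P *m Vh = P *m F by rewrite VhE mulmxDr mulmxA PY mul0mx add0r.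
have oP : opb P 1.
  move=> u; rewrite mul1r; have [->|] := eqVneq (enorm (u *m P)) 0; first exact: enorm_ge0.
  rewrite neq_lt ltNge enorm_ge0/= => h.
  rewrite -(ler_pM2l h) -expr2 enorm_sqr dotr_mul Psym dotrC -mulmxA PP.
  exact: dotr_le.
(* [P] annihilates [Y], hence [P V = P F]: the defect of orthogonality of [H] is quadratic in
   [eta]. *)
have HH : H^T *m H - 1%:M = - (F^T *m P *m F).
  have -> : F^T *m P *m F = Vh^T *m P *m Vh.
    have {1}-> : P = P^T *m P by rewrite Psym.
    rewrite -!mulmxA -PVh mulmxA -trmx_mul -PVh trmx_mul Psym -!mulmxA.
    by rewrite (mulmxA P) PP.
  rewrite /P mulmxBr mulmx1 mulmxBl VV opprB /H trmx_mul trmxK !mulmxA.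
  by [].
have oHH : opb (H^T *m H - 1%:M) (eta ^+ 2).
  rewrite HH; apply: opbN; rewrite expr2 -[X in _ * X]mul1r.
  by apply: opb_mul => //; apply: opb_mul => //; apply: opb_tr.
have [|Q [QQ hQ]] := near_orthogonal (sqr_ge0 eta) _ oHH.
  by have := mulr_ge0 eta0 eta0; nra.
exists Q; split=> //.
have b2 : b ^+ 2 / lam = eta ^+ 2 / 16.
  by rewrite /eta expr_div_n sl2 exprMn; field; rewrite gt_eqF.
have b3 : b ^+ 2 / Num.sqrt lam = b * eta / 4.
  by rewrite /eta; field; rewrite gt_eqF.
have dpos : 0 <= Num.sqrt d%:R * eta ^+ 2 :> R by rewrite mulr_ge0 ?sqrtr_ge0 ?sqr_ge0.
have beta0 : 0 <= b * eta by rewrite mulr_ge0.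
rewrite b2 b3; apply: norm2inf_le => [|i]; first by have := e0; have := a0; lra.
have oXs := row_embed_enorm hA (rA i).
(* [A V = Xs H] holds exactly, so the signal contributes only through [D - 1] and [H - Q]. The four
   pieces are at most [e], [2 sqrt d eta^2], [4 a] and [2 eta b]; with [eta = 4 b / sqrt lam] these
   are the four terms of the claim. *)
have -> : row i (sqrt_embed U l - Xs *m Q) =
    (D i - 1) *: (row i Xs *m H) + row i Xs *m (H - Q)
    + D i *: (row i W *m Y *m G) + D i *: (row i W *m F).
  have eAW : (A + W) *m Vh = Xs *m H + (W *m Y *m G + W *m F).
    by rewrite mulmxDl -{1}eXY -(mulmxA Xs) {2}VhE mulmxDr -(mulmxA W).
  rewrite mulmxBr linearB/= -BVh /B -(mulmxA (diagf D)) row_diagf eAW !linearD/=.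
  rewrite (row_mul i Xs H) (row_mul i Xs Q) (row_mul i (W *m Y)) (row_mul i W Y) (row_mul i W F).
  rewrite scalerBl scale1r [_ - _ + (_ - _)]addrA subrK -!addrA; congr (_ + _).
  by rewrite [RHS]addrC -addrA.
have t1 : enorm ((D i - 1) *: (row i Xs *m H)) <= e.
  rewrite enormZ -[leRHS]mulr1 ler_pM ?enorm_ge0//.
  by have := oH (row i Xs); rewrite oXs mulr1.
have t2 : enorm (row i Xs *m (H - Q)) <= 2 * Num.sqrt d%:R * eta ^+ 2.
  by have := hQ (row i Xs); rewrite oXs mulr1.
have Dn : `|D i| <= 2 by rewrite gtr0_norm.
have t3 : enorm (D i *: (row i W *m Y *m G)) <= 2 * (2 * a).
  rewrite enormZ ler_pM ?enorm_ge0//.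
  by apply: le_trans (oG _) _; rewrite ler_wpM2l.
have t4 : enorm (D i *: (row i W *m F)) <= 2 * (eta * b).
  rewrite enormZ ler_pM ?enorm_ge0//.
  by apply: le_trans (oF _) _; rewrite ler_wpM2l// enorm_row_le.
have := enormD ((D i - 1) *: (row i Xs *m H) + row i Xs *m (H - Q)
    + D i *: (row i W *m Y *m G)) (D i *: (row i W *m F)).
have := enormD ((D i - 1) *: (row i Xs *m H) + row i Xs *m (H - Q)) (D i *: (row i W *m Y *m G)).
have := enormD ((D i - 1) *: (row i Xs *m H)) (row i Xs *m (H - Q)).
lra.
Qed.
End Perturbation.
End Deterministic.

(** * Correlation matrices *)

Section Correlation.
Variable R : realType.
(** The squared norm of [x + y] differs from 1 by at most [2 a + b^2 <= 1/4], which puts the norm in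
    [[1/2, 5/4]]. A separate bound [a] for the inner product keeps the larger [b] out of the
    first-order part. *)
Lemma inv_enorm_near1 m (x y : 'rV[R]_m) (a b : R) : 0 <= a -> 0 <= b ->
  enorm x = 1 -> `|dotr x y| <= a -> enorm y <= b -> 2 * a + b ^+ 2 <= 1 / 4 ->
  [/\ 0 < enorm (x + y), (enorm (x + y))^-1 <= 2, enorm (x + y) <= 5 / 4 &
      `|(enorm (x + y))^-1 - 1| <= 2 * (2 * a + b ^+ 2)].
Proof.
move=> a0 b0 x1 xy yb ab.
have : dotr (x + y) (x + y) = 1 + 2 * dotr x y + enorm y ^+ 2.
  by rewrite !(dotrDl, dotrDr) -!enorm_sqr x1 (dotrC y x); ring.
have : enorm y ^+ 2 <= b ^+ 2 by rewrite ler_sqr ?nnegrE ?enorm_ge0.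
have := sqr_ge0 (enorm y).
rewrite -enorm_sqr; have := enorm_ge0 (x + y).
move: xy; rewrite ler_norml => /andP[].
move: (dotr x y) (enorm y ^+ 2) (enorm (x + y)) => c q N h1 h2 N0 q0 qb eN.
have bb : 0 <= b ^+ 2 by rewrite sqr_ge0.
have N2 : 3 / 4 <= N ^+ 2 <= 5 / 4 by apply/andP; split; lra.
have {N2}[N2 N2'] := andP N2.
have N12 : 1 / 2 <= N by rewrite leNgt; apply/negP => ?; nra.
have N54 : N <= 5 / 4 by rewrite leNgt; apply/negP => ?; nra.
have Np : 0 < N by lra.
have Ni : N^-1 <= 2 by rewrite -[2]invrK lef_pV2 ?posrE ?invr_gt0//; lra.
have Ni0 : 0 < N^-1 by rewrite invr_gt0.
split=> //.
have -> : N^-1 - 1 = (1 - N) * N^-1 by field; rewrite gt_eqF.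
rewrite normrM (ger0_norm (ltW Ni0)) mulrC ler_pM//; first exact: ltW.
have : `|1 - N| * (1 + N) <= 2 * a + b ^+ 2.
  have Na : 0 <= 1 + N by lra.
  rewrite -[X in _ * X](ger0_norm Na) -normrM ler_norml; apply/andP; split; nra.
have := normr_ge0 (1 - N); nra.
Qed.

Lemma embedding_perturbation n T d (A W : 'M[R]_(n, T)) (Us : 'M[R]_(n, d)) ls (lam a b : R) :
  is_nonzero_eigdecomp (A *m A^T) Us ls -> (forall i, enorm (row i A) = 1) ->
  0 < lam -> (forall j, lam <= ls j) -> 0 <= a -> 0 <= b ->
  16 * b <= Num.sqrt lam -> 2 * a + b ^+ 2 <= 1 / 4 -> opb W b ->
  (forall i, enorm (row i W *m right_factor A Us ls) <= a) ->
  let B := diagf (fun i => (enorm (row i (A + W)))^-1) *m (A + W) in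
  (forall i, 0 < enorm (row i (A + W))) /\
  forall (U : 'M[R]_(n, d)) l, is_top_eigpairs (B *m B^T) U l ->
    exists Q : 'M[R]_d, is_orthogonal_mx Q /\
    norm2inf (sqrt_embed U l - sqrt_embed Us ls *m Q) <=
      8 * a + 2 * b ^+ 2 + 32 * Num.sqrt d%:R * (b ^+ 2 / lam) + 8 * (b ^+ 2 / Num.sqrt lam).
Proof.
move=> hA rA lam0 hlam a0 b0 blam ab hW hWY B.
have H i : [/\ 0 < enorm (row i (A + W)), (enorm (row i (A + W)))^-1 <= 2,
      enorm (row i (A + W)) <= 5 / 4 &
      `|(enorm (row i (A + W)))^-1 - 1| <= 2 * (2 * a + b ^+ 2)].
  rewrite linearD/=; apply: inv_enorm_near1 => //; last exact: enorm_row_le.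
  (* Since [A = Xs Y^T], the inner product of the rows of [A] and [W] is that of the unit vector
     [Xs_i] with [W_i Y]. The row bound [a] therefore also controls the normalization, which
     accounts for half of [8 * a]. *)
  have := normr_dotr_le (row i (sqrt_embed Us ls)) (row i W *m right_factor A Us ls).
  rewrite (row_embed_enorm hA)// mul1r => /le_trans/(_ (hWY i)).
  by rewrite [dotr _ (_ *m right_factor _ _ _)]dotrC dotr_mul
    -row_mul (embed_right_factor hA) dotrC.
split=> [i|U l hU]; first by have [] := H i.
have hD0 i : 0 < (enorm (row i (A + W)))^-1 by have [h _ _ _] := H i; rewrite invr_gt0.
have hD2 i : (enorm (row i (A + W)))^-1 <= 2 by have [] := H i.
have hDi i : ((enorm (row i (A + W)))^-1)^-1 <= 5 / 4 by rewrite invrK; have [] := H i.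
have hDe i : `|(enorm (row i (A + W)))^-1 - 1| <= 2 * (2 * a + b ^+ 2) by have [] := H i.
have e0 : 0 <= 2 * (2 * a + b ^+ 2) by have := sqr_ge0 b; lra.
have [Q [oQ hQ]] :=
  embedding_perturbation_diag hA lam0 hlam b0 hW blam hD0 hD2 hDi hU a0 rA hWY e0 hDe.
exists Q; split=> //; apply: le_trans hQ _; lra.
Qed.

Lemma centering_tr T : (centering R T)^T = centering R T.
Proof. by rewrite /centering linearB/= trmx1 linearZ/= trmx_const. Qed.

Lemma centering_idem T : (0 < T)%N -> centering R T *m centering R T = centering R T.
Proof.
move=> T0; rewrite {2}/centering mulmxBr mulmx1 -scalemxAr.
rewrite [X in _ - _ *: X](_ : _ = 0) ?scaler0 ?subr0//.
rewrite /centering mulmxBl mul1mx -scalemxAl.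
have -> : (const_mx 1 : 'M[R]_T) *m (const_mx 1 : 'M[R]_T) = T%:R *: const_mx 1.
  apply/matrixP => i j; rewrite !mxE (eq_bigr (fun=> 1)) ?sumr_const ?card_ord ?mulr1//.
  by move=> k _; rewrite !mxE mulr1.
by rewrite scalerA mulVf ?scale1r ?subrr// pnatr_eq0 -lt0n.
Qed.

Lemma centering_opb T : (0 < T)%N -> opb (centering R T) 1.
Proof.
move=> T0 u; rewrite mul1r; set P := centering R T.
have [->|] := eqVneq (enorm (u *m P)) 0; first exact: enorm_ge0.
rewrite neq_lt ltNge enorm_ge0/= => h.
rewrite -(ler_pM2l h) -expr2 enorm_sqr dotr_mul centering_tr dotrC -mulmxA centering_idem//.
exact: dotr_le.
Qed.

Definition scaled_center n T (s : 'I_n -> R) (X : 'M[R]_(n, T)) : 'M[R]_(n, T) :=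
  (Num.sqrt T%:R)^-1 *: (diagf (fun i => (s i)^-1) *m X *m centering R T).

Lemma scaled_centerD n T (s : 'I_n -> R) (X X' : 'M[R]_(n, T)) :
  scaled_center s (X + X') = scaled_center s X + scaled_center s X'.
Proof. by rewrite /scaled_center (mulmxDr (diagf _)) mulmxDl scalerDr. Qed.

Lemma row_scaled_center n T (s : 'I_n -> R) (X : 'M[R]_(n, T)) i :
  row i (scaled_center s X) = ((Num.sqrt T%:R)^-1 * (s i)^-1) *: (row i X *m centering R T).
Proof.
by rewrite /scaled_center linearZ/= -mulmxA row_diagf row_mul scalerA.
Qed.

Definition stddev n T (X : 'M[R]_(n, T)) i := Num.sqrt (sigma2 X i).

Lemma sigma2E n T (X : 'M[R]_(n, T)) i :
  sigma2 X i = T%:R^-1 * enorm (row i X *m centering R T) ^+ 2.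
Proof. by rewrite enorm_sqr dotrr_sum. Qed.

Lemma enorm_row_scaled_center n T (s : 'I_n -> R) (X : 'M[R]_(n, T)) i : 0 <= s i ->
  enorm (row i (scaled_center s X)) = (s i)^-1 * stddev X i.
Proof.
move=> s0; rewrite row_scaled_center enormZ normrM !normfV !ger0_norm ?sqrtr_ge0//.
rewrite /stddev sigma2E sqrtrM ?invr_ge0// sqrtr_sqr ger0_norm ?enorm_ge0//.
by rewrite sqrtrV// mulrA [_^-1 * _]mulrC.
Qed.

Lemma corrE n T (X : 'M[R]_(n, T)) : (0 < T)%N ->
  corr X = scaled_center (stddev X) X *m (scaled_center (stddev X) X)^T.
Proof.
move=> T0; rewrite /corr /scaled_center /stddev -/(diagf _).
rewrite linearZ/= -scalemxAl -scalemxAr scalerA -invfM -expr2 sqr_sqrtr ?ler0n//; congr (_ *: _).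
rewrite (trmx_mul _ (centering R T)) (trmx_mul (diagf _)) tr_diagf centering_tr !mulmxA.
by rewrite -(mulmxA _ (centering R T) (centering R T)) centering_idem.
Qed.

(** Correlations are invariant under positive rescaling of rows. The noisy data can thus be divided
    by the deterministic signal deviations, so that signal and noise separate additively before the
    random normalization. *)
Lemma corr_normalize n T (s : 'I_n -> R) (X : 'M[R]_(n, T)) : (0 < T)%N ->
  (forall i, 0 < s i) ->
  let Y := scaled_center s X in
  let B := diagf (fun i => (enorm (row i Y))^-1) *m Y in corr X = B *m B^T.
Proof.
move=> T0 s0 Y B; suff -> : B = scaled_center (stddev X) X by rewrite corrE.
apply/row_matrixP => i; rewrite /B row_diagf enorm_row_scaled_center ?ltW//.
rewrite !row_scaled_center scalerA; congr (_ *: _).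
have sN0 : s i != 0 by rewrite gt_eqF.
rewrite invfM invrK -mulrA [_^-1 * (_ * _)]mulrCA mulrA mulrCA.
by rewrite divff// mulr1.
Qed.

Lemma enorm_row_standardized n T (X : 'M[R]_(n, T)) i : 0 < sigma2 X i ->
  enorm (row i (scaled_center (stddev X) X)) = 1.
Proof.
move=> h; rewrite enorm_row_scaled_center ?sqrtr_ge0// mulVf//.
by rewrite gt_eqF// sqrtr_gt0.
Qed.

End Correlation.

(** * Independence and linear statistics of the noise *)

Section IndicatorDetermines.
Local Open Scope ereal_scope.
Context d (Om : measurableType d) (R : realType) (P : {measure set Om -> \bar R}).
Variables (X : Om -> R) (mX : measurable_fun setT X).

Import HBNNSimple.

Lemma integral_nnsfun_comp_mul (G : Om -> \bar R) (h : {nnsfun R >-> R}) :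
  measurable_fun setT G -> (forall w, 0 <= G w) ->
  \int[P]_w ((h (X w))%:E * G w) =
  \sum_(y \in range h) y%:E * \int[P]_w ((\1_(h @^-1` [set y]) (X w))%:E * G w).
Proof.
move=> mG G0.
have mI y : measurable_fun setT (fun w => (\1_(h @^-1` [set y]) (X w) : R)).
  by apply: measurableT_comp.
under eq_integral => w _.
  rewrite fimfunE -fsumEFin// ge0_mule_fsuml; last first.
    by move=> y; rewrite EFinM nnfun_muleindic_ge0.
  over.
rewrite ge0_integral_fsum//; first last.
- by move=> y w _; rewrite mule_ge0// EFinM nnfun_muleindic_ge0.
- move=> y; apply: emeasurable_funM => //.
  by apply/measurable_EFinP; apply: measurable_funM => //.
apply: eq_fsbigr => y /[!inE] -[x _ hx].
rewrite -ge0_integralZl//.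
- by apply: eq_integral => w _; rewrite EFinM muleA.
- by apply: emeasurable_funM => //; apply/measurable_EFinP.
- by move=> w _; rewrite mule_ge0// lee_fin.
- by rewrite lee_fin -hx.
Qed.

(** Simple functions, then monotone convergence, with the weights [G] and [G'] held fixed. *)
Lemma integral_comp_mul_ext (G G' : Om -> \bar R) :
  measurable_fun setT G -> (forall w, 0 <= G w) ->
  measurable_fun setT G' -> (forall w, 0 <= G' w) ->
  (forall B : set R, measurable B ->
    \int[P]_w ((\1_B (X w))%:E * G w) = \int[P]_w ((\1_B (X w))%:E * G' w)) ->
  forall g : R -> R, measurable_fun setT g -> (forall x, 0 <= g x)%R ->
  \int[P]_w ((g (X w))%:E * G w) = \int[P]_w ((g (X w))%:E * G' w).
Proof.
move=> mG G0 mG' G'0 h g mg g0.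
have mEg : measurable_fun setT (EFin \o g) by apply/measurable_EFinP.
pose f_ := nnsfun_approx measurableT mEg.
have lim (H : Om -> \bar R) : measurable_fun setT H -> (forall w, 0 <= H w) ->
    \int[P]_w ((g (X w))%:E * H w) = limn (fun n => \int[P]_w ((f_ n (X w))%:E * H w)).
  move=> mH H0; rewrite -monotone_convergence//=.
  - apply: eq_integral => w _; apply/esym/cvg_lim => //.
    have fg : EFin \o (fun n => f_ n (X w)) @ \oo --> (g (X w))%:E.
      by apply: (cvg_nnsfun_approx measurableT mEg) => // x _; rewrite lee_fin.
    (* [H w] may be infinite, and continuity of the product fails at zero times infinity; when
       [g (X w)] is zero all approximants vanish as well. *)
    have [gX0|gX0] := eqVneq (g (X w)) 0%R.
      rewrite gX0 mul0e; apply: cvg_near_cst; apply: nearW => n.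
      have : f_ n (X w) = 0%R.
        apply/eqP; rewrite eq_le fun_ge0 andbT -gX0 -lee_fin.
        rewrite /f_ nnsfun_approxE.
        by apply: (@le_approx _ _ _ setT (EFin \o g)) => // x _; rewrite lee_fin.
      by move=> ->; rewrite mul0e.
    apply: cvgeM => //; last exact: cvg_cst.
    by rewrite /mule_def; case: (H w).
  - move=> n; apply: emeasurable_funM => //; apply/measurable_EFinP.
    exact: measurableT_comp.
  - by move=> n w _; rewrite mule_ge0// lee_fin.
  - move=> w _ a b ab; apply: lee_wpmul2r => //.
    by rewrite lee_fin; exact/lefP/nd_nnsfun_approx.
rewrite !lim//; congr (limn _); apply/funext => n.
rewrite !integral_nnsfun_comp_mul//; apply: eq_fsbigr => y _.
by rewrite h.
Qed.

End IndicatorDetermines.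

Section Update.
Variables (R : comPzRingType) (n T : nat) (S : Type).
Implicit Types (F : 'I_n -> 'I_T -> S -> R) (h : S -> R).

Definition upd F i0 t0 h (i : 'I_n) (t : 'I_T) : S -> R :=
  if (i == i0) && (t == t0) then h else F i t.

Lemma upd_row_prod F i0 t0 h (x : 'I_T -> S) :
  \prod_t upd F i0 t0 h i0 t (x t) =
  h (x t0) * \prod_t upd F i0 t0 (fun=> 1) i0 t (x t).
Proof.
rewrite (bigD1 t0)//= [in RHS](bigD1 t0)//= /upd !eqxx/= mul1r; congr (_ * _).
by apply: eq_bigr => t /negPf ->.
Qed.

Lemma upd_other_prod F i0 t0 h h' (x : 'I_T -> S) i : i != i0 ->
  \prod_t upd F i0 t0 h i t (x t) = \prod_t upd F i0 t0 h' i t (x t).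
Proof. by move=> /negPf h0; apply: eq_bigr => t _; rewrite /upd h0. Qed.

Lemma upd_prod F i0 t0 h (x : 'I_n -> 'I_T -> S) :
  \prod_i \prod_t upd F i0 t0 h i t (x i t) =
  h (x i0 t0) * \prod_i \prod_t upd F i0 t0 (fun=> 1) i t (x i t).
Proof.
rewrite (bigD1 i0)//= [in RHS](bigD1 i0)//= mulrA -upd_row_prod; congr (_ * _).
by apply: eq_bigr => i i0i; exact: upd_other_prod.
Qed.

End Update.

Section Independence.
Context d (Om : measurableType d) (R : realType) (P : probability Om R).
Variables (n T : nat) (N : Om -> 'M[R]_(n, T)).
Hypotheses (mN : forall i t, measurable_fun setT (fun w => N w i t))
  (indN : rows_independent P N).

Lemma measurable_rect (I : finType) (X : I -> Om -> R) (B : I -> set R) :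
  (forall i, measurable_fun setT (X i)) -> (forall i, measurable (B i)) ->
  measurable [set w | forall i, B i (X i w)].
Proof.
move=> mX mB; rewrite (_ : [set _ | _] = \bigcap_(i in [set: I]) (X i @^-1` B i)).
  apply: fin_bigcap_measurable => // i _.
  by rewrite -[_ @^-1` _]setTI; exact: mX.
by apply/seteqP; split=> w /= h i => [_|]; apply: h.
Qed.

Lemma prod_indic (I : finType) (X : I -> Om -> R) (B : I -> set R) w :
  \prod_i \1_(B i) (X i w) = \1_[set w | forall i, B i (X i w)] w :> R.
Proof.
have [h|h] := pselect (forall i, B i (X i w)).
  by rewrite [RHS]indicE mem_set// big1// => i _; rewrite indicE mem_set.
rewrite [RHS]indicE memNset//.
have [i hi] : exists i, ~ B i (X i w) by apply/existsNP.
by rewrite (bigD1 i)//= indicE memNset// mul0r.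
Qed.

Lemma measurable_double_prod (F : 'I_n -> 'I_T -> R -> R) :
  (forall i t, measurable_fun setT (F i t)) ->
  measurable_fun setT (fun w => \prod_i \prod_t F i t (N w i t)).
Proof.
move=> mF; apply: measurable_prod => i _; apply: measurable_prod => t _.
exact: measurableT_comp.
Qed.

Lemma measurable_row_prod (F : 'I_n -> 'I_T -> R -> R) i :
  (forall i t, measurable_fun setT (F i t)) ->
  measurable_fun setT (fun w => \prod_t F i t (N w i t)).
Proof.
move=> mF; apply: measurable_prod => t _.
exact: measurableT_comp.
Qed.

Local Open Scope ereal_scope.

(* The coordinates of [N] are freed one at a time: those in [s] carry arbitrary
   nonnegative functions, the others indicators. *)
Lemma expectation_row_prod_seq (s : seq ('I_n * 'I_T)) (f : 'I_n -> 'I_T -> R -> R)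
    (B : 'I_n -> 'I_T -> set R) :
  (forall i t, measurable_fun setT (f i t)) -> (forall i t x, 0 <= f i t x)%R ->
  (forall i t, measurable (B i t)) ->
  let F i t : R -> R := if (i, t) \in s then f i t else \1_(B i t) in
  \int[P]_w (\prod_i \prod_t F i t (N w i t))%:E =
  \prod_i \int[P]_w (\prod_t F i t (N w i t))%:E.
Proof.
move=> mf f0; elim: s B => [|[i0 t0] s IH] B mB F.
  rewrite /F/=.
  under eq_integral => w _.
    rewrite (eq_bigr (fun i => \1_[set w | forall t, B i t (N w i t)] w)); last first.
      by move=> i _; rewrite -prod_indic.
    rewrite (_ : \prod_i _ = \1_[set w | forall i t, B i t (N w i t)] w)%R; last first.
      have [h|h] := pselect (forall i t, B i t (N w i t)).
        by rewrite [RHS]indicE mem_set// big1// => i _; rewrite indicE (mem_set (h i)).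
      rewrite [RHS]indicE memNset//.
      have [i hi] : exists i, ~ forall t, B i t (N w i t) by apply/existsNP.
      by rewrite (bigD1 i)//= indicE memNset// mul0r.
    over.
  have mr i : measurable [set w | forall t, B i t (N w i t)].
    exact: (@measurable_rect _ (fun t w => N w i t) (B i)).
  have mall : measurable [set w | forall i t, B i t (N w i t)].
    rewrite (_ : [set _ | _] = \bigcap_(i in [set: 'I_n]) [set w | forall t, B i t (N w i t)]).
      exact: fin_bigcap_measurable.
    by apply/seteqP; split=> w /= h i => [_|]; apply: h.
  rewrite integral_indic// setIT; apply: (eq_trans (indN mB)); apply: eq_bigr => i _.
  have := @integral_indic _ _ _ P _ measurableT _ (mr i); rewrite setIT => <-.
  by apply: eq_integral => w _; rewrite -prod_indic.
have mF i t : measurable_fun setT (F i t).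
  by rewrite /F; case: ifP => _ //; exact: measurable_indic.
have F0 i t x : (0 <= F i t x)%R.
  by rewrite /F; case: ifP => _ //; rewrite indicE.
pose F1 := upd F i0 t0 (fun=> 1%R).
have mF1 i t : measurable_fun setT (F1 i t).
  by rewrite /F1 /upd; case: ifP.
have F10 i t x : (0 <= F1 i t x)%R.
  by rewrite /F1 /upd; case: ifP.
have [ins|ins] := boolP ((i0, t0) \in s).
  have := IH B mB; congr (_ = _).
    apply: eq_integral => w _; congr EFin; apply: eq_bigr => i _; apply: eq_bigr => t _.
    by rewrite /F inE; case: eqP => [->|//]; rewrite ins.
  apply: eq_bigr => i _; apply: eq_integral => w _; congr EFin; apply: eq_bigr => t _.
  by rewrite /F inE; case: eqP => [->|//]; rewrite ins.
(* [G] and [G'] are the integrands of the two sides with the factor at [(i0, t0)] set to 1; the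
   other rows of the right side enter [G'] as the constant [c]. Both sides become integrals of
   [h (N w i0 t0)] against a fixed weight. *)
pose G w := (\prod_i \prod_t F1 i t (N w i t))%:E.
pose c := \prod_(i < n | i != i0) \int[P]_w (\prod_t F1 i t (N w i t))%:E.
pose G' w := c * (\prod_t F1 i0 t (N w i0 t))%:E.
have c0 : 0 <= c.
  rewrite /c; elim/big_ind : _ => //; first by move=> *; exact: mule_ge0.
  by move=> i _; apply: integral_ge0 => w _; rewrite lee_fin; apply: prodr_ge0.
have mG : measurable_fun setT G by apply/measurable_EFinP; exact: measurable_double_prod.
have G0 w : 0 <= G w.
  by rewrite lee_fin; apply: prodr_ge0 => i _; apply: prodr_ge0.
have mrow : measurable_fun setT (fun w => (\prod_t F1 i0 t (N w i0 t))%:E).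
  by apply/measurable_EFinP; exact: measurable_row_prod.
have mG' : measurable_fun setT G' by apply: emeasurable_funM.
have G'0 w : 0 <= G' w.
  by rewrite mule_ge0// lee_fin; apply: prodr_ge0.
have L (h : R -> R) : \int[P]_w (\prod_i \prod_t upd F i0 t0 h i t (N w i t))%:E =
    \int[P]_w ((h (N w i0 t0))%:E * G w).
  by apply: eq_integral => w _; rewrite upd_prod EFinM.
have RR (h : R -> R) : measurable_fun setT h -> (forall x, 0 <= h x)%R ->
    \prod_i \int[P]_w (\prod_t upd F i0 t0 h i t (N w i t))%:E =
    \int[P]_w ((h (N w i0 t0))%:E * G' w).
  move=> mh h0; rewrite (bigD1 i0)//= muleC.
  rewrite (eq_bigr (fun i => \int[P]_w (\prod_t F1 i t (N w i t))%:E)); last first.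
    by move=> i ii0; apply: eq_integral => w _; congr EFin; exact: upd_other_prod.
  rewrite -/c -ge0_integralZl//.
  - apply: eq_integral => w _; rewrite /G' muleCA; congr (_ * _).
    by rewrite -EFinM; congr EFin; rewrite upd_row_prod.
  - apply/measurable_EFinP; apply: measurable_row_prod => i t.
    by rewrite /upd; case: ifP.
  - by move=> w _; rewrite lee_fin; apply: prodr_ge0 => t _; rewrite /upd; case: ifP.
have FE i t : F i t = upd F i0 t0 (f i0 t0) i t.
  rewrite /upd; case: ifP => // /andP[/eqP -> /eqP ->].
  by rewrite /F inE eqxx.
have -> : F = upd F i0 t0 (f i0 t0) by apply/funext => i; apply/funext => t; exact: FE.
(* It remains to compare indicators at [(i0, t0)], which is the induction hypothesis with that one
   set of [B] replaced by [B']. *)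
rewrite L RR//; apply: integral_comp_mul_ext => // B' mB'.
rewrite -L -RR//.
pose B2 i t := if (i == i0) && (t == t0) then B' else B i t.
have E2 i t : (if (i, t) \in s then f i t else \1_(B2 i t) : R -> R) = upd F i0 t0 \1_B' i t.
  rewrite /upd /B2 /F inE xpair_eqE.
  by case: (boolP (_ && _)) => //= /andP[/eqP -> /eqP ->]; rewrite (negPf ins).
have mB2 i t : measurable (B2 i t) by rewrite /B2; case: ifP.
have := IH B2 mB2; congr (_ = _).
  apply: eq_integral => w _; congr EFin; apply: eq_bigr => i _; apply: eq_bigr => t _.
  by rewrite -E2.
apply: eq_bigr => i _; apply: eq_integral => w _; congr EFin; apply: eq_bigr => t _.
by rewrite -E2.
Qed.

Lemma expectation_row_prod (f : 'I_n -> 'I_T -> R -> R) :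
  (forall i t, measurable_fun setT (f i t)) -> (forall i t x, 0 <= f i t x)%R ->
  \int[P]_w (\prod_i \prod_t f i t (N w i t))%:E =
  \prod_i \int[P]_w (\prod_t f i t (N w i t))%:E.
Proof.
move=> mf f0.
have := @expectation_row_prod_seq (enum [set: 'I_n * 'I_T]%SET) f (fun _ _ => setT) mf f0.
move=> /(_ (fun _ _ => measurableT)) /=.
congr (_ = _).
  apply: eq_integral => w _; congr EFin; apply: eq_bigr => i _; apply: eq_bigr => t _.
  by rewrite mem_enum inE.
apply: eq_bigr => i _; apply: eq_integral => w _; congr EFin; apply: eq_bigr => t _.
by rewrite mem_enum inE.
Qed.

End Independence.

Definition fdot (R : realType) n T (C X : 'M[R]_(n, T)) : R :=
  \sum_i \sum_t C i t * X i t.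

Lemma prode_le (R : realType) (I : finType) (a b : I -> \bar R) :
  (forall i, 0 <= a i <= b i)%E -> (\prod_i a i <= \prod_i b i)%E.
Proof.
move=> h; suff : (0 <= \prod_i a i <= \prod_i b i)%E by case/andP.
elim/big_ind2 : _ => //; first by rewrite lee_fin ler01 lexx.
move=> x1 x2 y1 y2 /andP[x10 x12] /andP[y10 y12].
by rewrite mule_ge0//= lee_pmul.
Qed.

(** * Subgaussian tails of linear forms in the noise *)

Section LinearStatistics.
Context d (Om : measurableType d) (R : realType) (P : probability Om R).
Variables (n T : nat) (N : Om -> 'M[R]_(n, T)) (nu : 'I_n -> R).
Hypothesis hN : noise_assumption P N nu.

Definition var_proxy (C : 'M[R]_(n, T)) : R :=
  \sum_i nu i * dotr (row i C) (row i C).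

Lemma measurable_fdot (C : 'M[R]_(n, T)) : measurable_fun setT (fun w => fdot C (N w)).
Proof.
have [mN _ _ _ _] := hN.
apply: measurable_sum => i; apply: measurable_sum => t.
by apply: measurable_funM.
Qed.

Local Open Scope ereal_scope.

Lemma row_mgf_le i (c : 'rV[R]_T) :
  \int[P]_w (expR (dotr c (row i (N w))))%:E <= (expR (nu i * dotr c c / 2))%:E.
Proof.
have [_ _ _ _ hs] := hN.
have [->|c0] := eqVneq c 0%R.
  rewrite dotr0 mulr0 mul0r expR0.
  under eq_integral => w _ do rewrite dotrC dotr0 expR0.
  by rewrite integral_cst//= mul1e probability_setT.
have e0 : enorm c != 0%R by rewrite enorm_eq0.
pose u := ((enorm c)^-1 *: c)%R.
have := hs i u; rewrite -dotrr_sum dotrZl dotrZr -enorm_sqr mulrA -invfM -expr2.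
rewrite mulVf ?sqrf_eq0// => /(_ erefl (enorm c)).
rewrite enorm_sqr [(dotr c c * nu i)%R]mulrC; congr (_ <= _).
apply: eq_integral => w _; congr (expR _)%:E.
by rewrite -/(dotr u (row i (N w))) dotrZl mulrA divff// mul1r.
Qed.

(** The exponential of a linear form is a product of functions of single coordinates, so
    independence tested on rectangles suffices to factor it over rows; within a row the vector
    subgaussian bound applies. *)
Lemma mgf_le (C : 'M[R]_(n, T)) s v : (var_proxy C <= v)%R ->
  \int[P]_w (expR (s * fdot C (N w)))%:E <= (expR (s ^+ 2 * v / 2))%:E.
Proof.
have [mN iN _ _ _] := hN => Cv.
have -> : \int[P]_w (expR (s * fdot C (N w)))%:E =
    \int[P]_w (\prod_i \prod_t expR (s * C i t * N w i t))%:E.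
  apply: eq_integral => w _; congr EFin; rewrite /fdot mulr_sumr expR_sum.
  apply: eq_bigr => i _; rewrite mulr_sumr expR_sum; apply: eq_bigr => t _.
  by rewrite mulrA.
rewrite (expectation_row_prod mN iN (f := fun i t x => expR (s * C i t * x))); first last.
- by move=> i t x; exact: expR_ge0.
- by move=> i t; apply: measurableT_comp => //; exact: measurable_funM.
apply: (@le_trans _ _ (\prod_i (expR (nu i * dotr (s *: row i C)%R (s *: row i C)%R / 2))%:E)).
  apply: prode_le => i; rewrite integral_ge0/=; last first.
    by move=> w _; rewrite lee_fin; apply: prodr_ge0 => t _; exact: expR_ge0.
  apply: le_trans (row_mgf_le i (s *: row i C)%R).
  rewrite le_eqVlt; apply/orP; left; apply/eqP.
  apply: eq_integral => w _; congr EFin; rewrite dotrE expR_sum.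
  by apply: eq_bigr => t _; rewrite !mxE.
rewrite -(big_morph EFin EFinM erefl) lee_fin -expR_sum ler_expR.
rewrite -mulr_suml ler_pM2r// (le_trans _ (ler_wpM2l (sqr_ge0 s) Cv))//.
rewrite /var_proxy mulr_sumr le_eqVlt; apply/orP; left; apply/eqP.
by apply: eq_bigr => i _; rewrite dotrZl dotrZr; ring.
Qed.

Lemma linear_tail (C : 'M[R]_(n, T)) (v t : R) : (0 < v)%R -> (0 < t)%R ->
  (var_proxy C <= v)%R ->
  P [set w | (t <= fdot C (N w))%R] <= (expR (- (t ^+ 2 / (2 * v))))%:E.
Proof.
move=> v0 t0 Cv.
pose X : {RV P >-> R} := mfun_Sub (mem_set (measurable_fdot C)).
have XE w : X w = fdot C (N w) by [].
(* [t / v] minimizes the Chernoff exponent [r^2 v / 2 - r t]. *)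
have r0 : (0 < t / v)%R by rewrite divr_gt0.
have := chernoff X t r0; rewrite /= => /le_trans; apply.
rewrite /mmt_gen_fun unlock.
have := mgf_le (t / v) Cv => h.
apply: (@le_trans _ _ ((expR ((t / v) ^+ 2 * v / 2))%:E * (expR (- (t / v * t)))%:E)).
  apply: lee_wpmul2r; first by rewrite lee_fin expR_ge0.
  apply: le_trans h; rewrite le_eqVlt; apply/orP; left; apply/eqP.
  by apply: eq_integral => w _ /=; rewrite mulrC.
rewrite -EFinM -expRD lee_fin ler_expR le_eqVlt; apply/orP; left; apply/eqP.
by field; rewrite gt_eqF.
Qed.

Lemma measurable_fdot_ge (C : 'M[R]_(n, T)) t : measurable [set w | (t <= fdot C (N w))%R].
Proof.
rewrite (_ : [set _ | _] = (fun w => fdot C (N w)) @^-1` `[t, +oo[%classic).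
  by rewrite -[_ @^-1` _]setTI; apply: measurable_fdot.
by apply/seteqP; split=> w /=; rewrite in_itv/= andbT.
Qed.

Lemma finite_tail_bound (J : finType) (C : J -> 'M[R]_(n, T)) (t v : J -> R) (e : R) :
  (forall j, 0 < t j)%R -> (forall j, 0 < v j)%R -> (forall j, var_proxy (C j) <= v j)%R ->
  (\sum_j expR (- (t j ^+ 2 / (2 * v j))) <= e)%R ->
  let E := [set w | forall j, (fdot (C j) (N w) < t j)%R] in
  measurable E /\ (1 - e)%:E <= P E.
Proof.
move=> t0 v0 Cv he E.
pose B (s : seq J) := [set w | exists2 j, j \in s & (t j <= fdot (C j) (N w))%R].
have BC j s : B (j :: s) = [set w | (t j <= fdot (C j) (N w))%R] `|` B s.
  apply/seteqP; split=> w /=.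
    by move=> [k]; rewrite inE => /predU1P[->|ks] h; [left|right; exists k].
  by move=> [h|[k ks h]]; [exists j; rewrite ?mem_head|exists k; rewrite ?inE ?ks ?orbT].
have B0 : B [::] = set0 by apply/seteqP; split=> w //= -[].
have mB s : measurable (B s).
  elim: s => [|j s IH]; first by rewrite B0; exact: measurable0.
  by rewrite BC; apply: measurableU => //; exact: measurable_fdot_ge.
have PB s : P (B s) <= (\sum_(j <- s) expR (- (t j ^+ 2 / (2 * v j))))%:E.
  elim: s => [|j s IH]; first by rewrite B0 measure0 big_nil.
  rewrite BC big_cons EFinD; apply: le_trans (measureU2 _ _ _) _ => //.
    exact: measurable_fdot_ge.
  by apply: leeD => //; exact: linear_tail.
have EB : E = ~` B (enum J).
  apply/seteqP; split=> w /=.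
    by move=> h [j _]; rewrite leNgt h.
  by move=> h j; rewrite ltNge; apply/negP => hj; apply: h; exists j => //; rewrite mem_enum.
rewrite EB; split; first exact: measurableC.
rewrite probability_setC// EFinB leeB//; apply: le_trans (PB _) _.
by rewrite lee_fin big_enum.
Qed.

End LinearStatistics.

(** * Spectral norm of the noise *)

(* Points of [m^(-1/2) Z^m] in the ball of radius 2, coded by signs and absolute values. *)
Definition lattice_code m := {ffun 'I_m -> bool * 'I_(2 * m + 2)}.

Definition short_code m : pred (lattice_code m) :=
  fun f => (\sum_t (f t).2 ^ 2 <= 4 * m)%N.

Definition lattice_net m := {f : lattice_code m | short_code f}.

Section Net.
Variable R : realType.

Definition lattice_vec m (f : lattice_code m) : 'rV[R]_m :=
  \row_t ((-1) ^+ (f t).1 * ((f t).2 : nat)%:R / Num.sqrt m%:R).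

Lemma lattice_vec_norm m (f : lattice_code m) : (0 < m)%N -> short_code f ->
  dotr (lattice_vec f) (lattice_vec f) <= 4.
Proof.
move=> m0 hf; have mR : 0 < m%:R :> R by rewrite ltr0n.
rewrite dotrr_sum (eq_bigr (fun t => (((f t).2 : nat)%:R ^+ 2) / m%:R)); last first.
  move=> t _; rewrite mxE expr_div_n exprMn sqrr_sign mul1r.
  by rewrite sqr_sqrtr// ltW.
rewrite -mulr_suml ler_pdivrMr// -natrM.
rewrite (eq_bigr (fun t => ((f t).2 ^ 2)%N%:R)) => [|t _]; last by rewrite natrX.
by rewrite -natr_sum ler_nat.
Qed.

(* Rounding each coordinate away from zero, with the sign of [g], can only increase [dotr _ g]. *)
Lemma lattice_net_dominates m (u g : 'rV[R]_m) : (0 < m)%N -> dotr u u <= 1 ->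
  exists f : lattice_net m, dotr u g <= dotr (lattice_vec (val f)) g.
Proof.
move=> m0 hu; have mR : 0 < m%:R :> R by rewrite ltr0n.
have sm : 0 < Num.sqrt m%:R :> R by rewrite sqrtr_gt0.
have m1 : 1 <= m%:R :> R by rewrite ler1n.
have sm2 : Num.sqrt m%:R ^+ 2 = m%:R :> R by rewrite sqr_sqrtr// ltW.
pose x t := `|u 0 t| * Num.sqrt m%:R.
have x0 t : 0 <= x t by rewrite mulr_ge0// ltW.
pose k t := (Num.truncn (x t)).+1.
have kx t : x t <= (k t)%:R <= x t + 1.
  have := truncn_itv (x0 t); rewrite /k -natr1 lerD2r => /andP[-> h].
  by rewrite andbT ltW// natr1.
have u1 t : `|u 0 t| <= 1.
  rewrite -[leRHS]normr1 -ler_sqr ?nnegrE//= !real_normK ?num_real// expr1n.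
  apply: le_trans hu; rewrite dotrr_sum (bigD1 t)//= lerDl.
  by apply: sumr_ge0 => j _; exact: sqr_ge0.
have sm_le : Num.sqrt m%:R <= m%:R :> R by
  rewrite -[leRHS]sm2 expr2 ler_peMl ?sqrtr_ge0// -[leLHS]sqrtr1 ler_wsqrtr.
have kb t : (k t < 2 * m + 2)%N.
  rewrite -(ltr_nat R); have /andP[_ h] := kx t; apply: le_lt_trans h _.
  rewrite natrD natrM; have : x t <= m%:R.
    by apply: le_trans sm_le; rewrite ler_piMl ?sqrtr_ge0.
  lra.
pose f : lattice_code m := [ffun t => (g 0 t < 0, Ordinal (kb t))].
have hf : short_code f.
  rewrite /short_code -(ler_nat R) natr_sum.
  (* From [(x + 1)^2 <= 2 x^2 + 2], rounding up costs [2 m] on top of [2 m |u|^2]: this is the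
     budget [4 * m] of [short_code]. *)
  apply: (@le_trans _ _ (\sum_t (2 * m%:R * u 0 t ^+ 2 + 2))).
    apply: ler_sum => t _; rewrite ffunE /= natrX.
    have /andP[_ h] := kx t.
    have e : x t ^+ 2 = m%:R * u 0 t ^+ 2 by rewrite exprMn sm2 real_normK ?num_real// mulrC.
    apply: (@le_trans _ _ ((x t + 1) ^+ 2)); first by rewrite ler_sqr ?nnegrE ?addr_ge0.
    by rewrite -mulrA -e; have := sqr_ge0 (x t - 1); nra.
  rewrite big_split/= -mulr_sumr -dotrr_sum sumr_const card_ord natrM -[2 *+ m]mulr_natr.
  have := ler_wpM2l (ltW mR) hu; lra.
exists (exist _ f hf); rewrite !dotrE; apply: ler_sum => t _.
rewrite mxE ffunE /=.
apply: (@le_trans _ _ (`|u 0 t| * `|g 0 t|)); first by rewrite -normrM ler_norm.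
set s := (-1) ^+ _; set K := _%:R.
have -> : s * K / Num.sqrt m%:R * g 0 t = K / Num.sqrt m%:R * `|g 0 t|.
  by rewrite [`|g 0 t|]normrEsign -/s; ring.
by rewrite ler_wpM2r// ler_pdivlMr//; have /andP[] := kx t.
Qed.

(** A generating-function count. Short codes satisfy [sum k <= sum k^2 <= 4 m], so the product of
    the weights [16 * 2^-k] is at least 1 on them. Summed over all codes, this product is the [m]-th
    power of a single sum, at most [2 * 16 * 2 = 64]. *)
Lemma card_lattice_net m : #|{: lattice_net m}|%:R <= 64 ^+ m :> R.
Proof.
rewrite card_sig.
pose h (p : bool * 'I_(2 * m + 2)) : R := 16 * 2^-1 ^+ p.2.
have h0 p : 0 <= h p by rewrite mulr_ge0// exprn_ge0.
apply: (@le_trans _ _ (\sum_(f : lattice_code m) \prod_t h (f t))).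
  rewrite -sum1_card natr_sum big_mkcond/=; apply: ler_sum => f _.
  case: ifP => [|_]; last by apply: prodr_ge0.
  rewrite inE /short_code => hf.
  rewrite big_split/= prodr_const card_ord prodrXr.
  have : (\sum_t (f t).2 <= 4 * m)%N.
    by apply: leq_trans hf; apply: leq_sum => t _; rewrite -mulnn; case: (val _) => // j;
      rewrite leq_pmull.
  move=> le.
  have -> : 16 ^+ m = 2 ^+ (4 * m) :> R by rewrite exprM; congr (_ ^+ _); ring.
  rewrite exprVn -ler_pdivrMr ?invr_gt0 ?exprn_gt0// invrK mul1r.
  by rewrite ler_eXn2l// ltr1n.
rewrite -(bigA_distr_bigA (fun _ p => h p)) prodr_const card_ord.
rewrite lerXn2r ?nnegrE//; first by apply: sumr_ge0.
rewrite -(pair_bigA _ (fun b k => h (b, k)))/= big_bool /h/= -!mulr_sumr.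
have : \sum_(i < 2 * m + 2) 2^-1 ^+ i <= 2 :> R.
  have -> K : \sum_(i < K) 2^-1 ^+ i = 2 - 2 * 2^-1 ^+ K :> R.
    elim: K => [|K IH]; first by rewrite big_ord0 expr0; lra.
    by rewrite big_ord_recr/= IH exprS; lra.
  by rewrite lerBlDr lerDl mulr_ge0// exprn_ge0.
lra.
Qed.

(** Domination is applied to one argument of the bilinear form at a time, the other being fixed. The
    net dominates the whole unit ball, so no approximation factor is lost. *)
Lemma opb_of_lattice_net n m (W : 'M[R]_(n, m)) b : (0 < n)%N -> (0 < m)%N ->
  (forall (p : lattice_net n) (q : lattice_net m),
     dotr (lattice_vec (val p) *m W) (lattice_vec (val q)) <= b) -> opb W b.
Proof.
move=> n0 m0 h.
have unit k (v : 'rV[R]_k) : v != 0 -> dotr ((enorm v)^-1 *: v) ((enorm v)^-1 *: v) <= 1.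
  move=> v0; rewrite dotrZl dotrZr -enorm_sqr mulrA -invfM -expr2 mulVf//.
  by rewrite sqrf_eq0 enorm_eq0.
have H (u : 'rV[R]_n) (v : 'rV[R]_m) : dotr u u <= 1 -> dotr v v <= 1 -> dotr (u *m W) v <= b.
  move=> u1 v1; rewrite dotrC.
  have [q] := lattice_net_dominates (u *m W) m0 v1; move/le_trans; apply.
  rewrite dotrC dotr_mul.
  have [p] := lattice_net_dominates (lattice_vec (val q) *m W^T) n0 u1; move/le_trans; apply.
  by rewrite -dotr_mul.
have b0 : 0 <= b.
  by have := H 0 0; rewrite mul0mx !dotr0 ler01; apply.
move=> u; have [uW0|uW0] := eqVneq (u *m W) 0.
  by rewrite uW0 enorm0 mulr_ge0 ?enorm_ge0.
have u0 : u != 0 by apply: contraNneq uW0 => ->; rewrite mul0mx.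
have eu : 0 < enorm u by rewrite enorm_gt0.
have euW : 0 < enorm (u *m W) by rewrite enorm_gt0.
have := H _ _ (unit _ _ u0) (unit _ _ uW0).
rewrite -scalemxAl dotrZl dotrZr -enorm_sqr expr2 mulKf ?gt_eqF//.
by rewrite mulrC ler_pdivrMr.
Qed.

End Net.

Section Bilinear.
Variable R : realType.

Definition bilin_coef n T (s : 'I_n -> R) (p : 'rV[R]_n) (q : 'rV[R]_T) : 'M[R]_(n, T) :=
  \matrix_(i, t) ((Num.sqrt T%:R)^-1 * (s i)^-1 * p 0 i * (q *m centering R T) 0 t).

Lemma fdot_bilin_coef n T (s : 'I_n -> R) p q (X : 'M[R]_(n, T)) :
  fdot (bilin_coef s p q) X = dotr (p *m scaled_center s X) q.
Proof.
rewrite dotr_mul dotrE /fdot; apply: eq_bigr => i _.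
have -> : (q *m (scaled_center s X)^T) 0 i = dotr (row i (scaled_center s X)) q.
  by rewrite dotrC dotrE mxE; apply: eq_bigr => t _; rewrite !mxE.
rewrite row_scaled_center dotrZl dotr_mul centering_tr dotrE !mulr_sumr.
by apply: eq_bigr => t _; rewrite !mxE; ring.
Qed.

(** The scaling supplies [1 / T], each ratio [nu i / s i ^+ 2] is at most [1 / g], and centering
    contracts [q]. *)
Lemma var_proxy_bilin_coef n T (s nu : 'I_n -> R) p (q : 'rV[R]_T) (g : R) : (0 < T)%N ->
  0 < g -> (forall i, 0 < s i) -> (forall i, 0 < nu i) -> (forall i, g <= s i ^+ 2 / nu i) ->
  var_proxy nu (bilin_coef s p q) <= dotr p p * dotr q q / (T%:R * g).
Proof.
move=> T0 g0 s0 nu0 hg; have TR : 0 < T%:R :> R by rewrite ltr0n.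
have sT : Num.sqrt T%:R ^+ 2 = T%:R :> R by rewrite sqr_sqrtr// ltW.
have sT0 : 0 < Num.sqrt T%:R :> R by rewrite sqrtr_gt0.
have qM : dotr (q *m centering R T) (q *m centering R T) <= dotr q q.
  rewrite -!enorm_sqr ler_sqr ?nnegrE ?enorm_ge0//.
  by have := centering_opb T0 q; rewrite mul1r.
rewrite /var_proxy [dotr p p]dotrr_sum -mulrA mulr_suml; apply: ler_sum => i _.
have -> : row i (bilin_coef s p q) =
    ((Num.sqrt T%:R)^-1 * (s i)^-1 * p 0 i) *: (q *m centering R T).
  by apply/rowP => t; rewrite !mxE.
rewrite dotrZl dotrZr.
have si := s0 i; have nui := nu0 i.
have h1 : nu i / (s i ^+ 2) <= g^-1.
  by rewrite -[leLHS]invrK lef_pV2 ?posrE ?invr_gt0 ?divr_gt0 ?exprn_gt0// invf_div.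
set D := dotr _ _ in qM *.
have D0 : 0 <= D by exact: dotrr_ge0.
have -> : nu i * ((Num.sqrt T%:R)^-1 / s i * p 0 i * ((Num.sqrt T%:R)^-1 / s i * p 0 i * D)) =
    (p 0 i ^+ 2 / (Num.sqrt T%:R) ^+ 2) * ((nu i / s i ^+ 2) * D).
  by field; rewrite !gt_eqF.
rewrite sT.
have -> : p 0 i ^+ 2 * (dotr q q / (T%:R * g)) = (p 0 i ^+ 2 / T%:R) * (g^-1 * dotr q q).
  by field; rewrite !gt_eqF.
apply: ler_wpM2l; first by rewrite divr_ge0 ?sqr_ge0// ltW.
by apply: ler_pM => //; rewrite divr_ge0 ?sqr_ge0// ltW.
Qed.

End Bilinear.

(** * A single event controlling the noise *)

Section NoiseEvent.
Context d (Om : measurableType d) (R : realType) (P : probability Om R).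
Variables (n T r : nat) (N : Om -> 'M[R]_(n, T)) (nu : 'I_n -> R).
Hypothesis hN : noise_assumption P N nu.
Variables (s : 'I_n -> R) (g K L : R) (Y : 'M[R]_(T, r)).
Hypotheses (n0 : (0 < n)%N) (T0 : (0 < T)%N) (s0 : forall i, 0 < s i) (g0 : 0 < g)
  (hg : forall i, g <= s i ^+ 2 / nu i) (K0 : 0 < K) (L0 : 0 < L)
  (YY : Y^T *m Y = 1%:M).

Lemma noise_event : exists E : set Om,
  [/\ measurable E,
      ((1 - (64 ^+ n * 64 ^+ T * expR (- (K ^+ 2 * T%:R / 32))
        + 2 * (n%:R * r%:R) * expR (- (4 * L))))%:E <= P E)%E &
      forall w, E w -> opb (scaled_center s (N w)) (K / Num.sqrt g) /\
        forall i, enorm (row i (scaled_center s (N w)) *m Y) <=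
                  Num.sqrt (8 * (r%:R * L / (T%:R * g)))].
Proof.
have [_ _ _ nu0 _] := hN.
have TR : 0 < T%:R :> R by rewrite ltr0n.
have Tg : 0 < T%:R * g by rewrite mulr_gt0.
have sg : 0 < Num.sqrt g by rewrite sqrtr_gt0.
have sg2 : Num.sqrt g ^+ 2 = g by rewrite sqr_sqrtr// ltW.
(* One union bound serves both purposes: net pairs for the operator norm, and entries of [W Y] with
   a Boolean sign that makes one-sided tails two-sided. Net vectors have squared norm at most 4,
   hence the proxy [16 / (T g)] and the exponent [K^2 T / 32]. *)
pose J : finType := (lattice_net n * lattice_net T + 'I_n * 'I_r * bool)%type.
pose a := Num.sqrt (8 * (L / (T%:R * g))).
have a0 : 0 < a by rewrite sqrtr_gt0 mulr_gt0// divr_gt0.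
have a2 : a ^+ 2 = 8 * (L / (T%:R * g)) by rewrite sqr_sqrtr// ltW// mulr_gt0// divr_gt0.
pose C (j : J) := match j with
  | inl pq => bilin_coef s (lattice_vec R (val pq.1)) (lattice_vec R (val pq.2))
  | inr x => bilin_coef s ((-1) ^+ x.2 *: delta_mx 0 x.1.1) (col x.1.2 Y)^T
  end.
pose t (j : J) := if j is inl _ then K / Num.sqrt g else a.
pose v (j : J) := if j is inl _ then 16 / (T%:R * g) else (T%:R * g)^-1.
have t0 j : 0 < t j by case: j => [?|?] //=; rewrite divr_gt0.
have v0 j : 0 < v j by case: j => [?|?] /=; rewrite ?divr_gt0// invr_gt0.
have Yc j : dotr (col j Y)^T (col j Y)^T = 1.
  have /matrixP/(_ j j) := YY; rewrite [RHS]mxE eqxx mulr1n mxE => <-.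
  by rewrite dotrE; apply: eq_bigr => k _; rewrite !mxE.
have Cv j : var_proxy nu (C j) <= v j.
  case: j => [[p q]|[[i j] b]] /=; apply: le_trans (var_proxy_bilin_coef _ _ T0 g0 s0 nu0 hg) _.
    rewrite ler_wpM2r ?invr_ge0 ?(ltW Tg)//.
    have -> : 16 = 4 * 4 :> R by ring.
    by apply: ler_pM; rewrite ?dotrr_ge0// lattice_vec_norm// (valP p, valP q).
  rewrite Yc dotrZl dotrZr -enorm_sqr enorm_delta expr1n !mulr1 -expr2 sqrr_sign.
  by rewrite mul1r.
have hsum : \sum_j expR (- (t j ^+ 2 / (2 * v j))) <=
   64 ^+ n * 64 ^+ T * expR (- (K ^+ 2 * T%:R / 32)) + 2 * (n%:R * r%:R) * expR (- (4 * L)).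
  rewrite big_sumType/=; apply: lerD.
    rewrite sumr_const -[X in X <= _]mulr_natl.
    have -> : (K / Num.sqrt g) ^+ 2 / (2 * (16 / (T%:R * g))) = K ^+ 2 * T%:R / 32.
      by rewrite expr_div_n sg2; field; rewrite !gt_eqF.
    rewrite ler_wpM2r ?expR_ge0//.
    rewrite card_prod natrM; apply: ler_pM; rewrite ?ler0n//; exact: card_lattice_net.
  rewrite sumr_const -[X in X <= _]mulr_natl !card_prod !card_ord card_bool !natrM a2.
  have -> : 8 * (L / (T%:R * g)) / (2 * (T%:R * g)^-1) = 4 * L.
    by field; rewrite !gt_eqF.
  by rewrite [_ * 2]mulrC.
have [mE PE] := finite_tail_bound hN t0 v0 Cv hsum.
exists [set w | forall j, fdot (C j) (N w) < t j]; split=> // w hw; split.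
  apply: opb_of_lattice_net => // p q.
  by have := hw (inl (p, q)); rewrite /= fdot_bilin_coef => /ltW.
move=> i.
rewrite le_enorm ?sqrtr_ge0// sqr_sqrtr; last first.
  by rewrite mulr_ge0// divr_ge0 ?mulr_ge0// ltW.
have -> : 8 * (r%:R * L / (T%:R * g)) = \sum_(j < r) a ^+ 2.
  by rewrite sumr_const card_ord a2 -[X in _ = X]mulr_natl; field; rewrite !gt_eqF.
rewrite dotrr_sum; apply: ler_sum => j _.
set z := (_ *m _) 0 j.
have zE : z = dotr (row i (scaled_center s (N w))) (col j Y)^T.
  by rewrite /z mxE dotrE; apply: eq_bigr => k _; rewrite !mxE.
have h (b : bool) : (-1) ^+ b * z < a.
  by have := hw (inr (i, j, b)); rewrite /= fdot_bilin_coef -scalemxAl dotrZl -rowE -zE.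
have h1 := h true; have h2 := h false; rewrite expr0 mul1r in h2.
rewrite expr1 mulN1r in h1.
rewrite -[leLHS]real_normK ?num_real// ler_sqr ?nnegrE ?(ltW a0)// ler_norml.
by apply/andP; split; lra.
Qed.

End NoiseEvent.

(** * Assembling the bound *)

Section FixedIndex.
Variable R : realType.

(** Each summand is compared with [tau * br]. The first gives [8 sqrt (8 cn)], the third [2 K], and
    the second and fourth together [(2 + 8) K^2]. *)
Lemma rate_bound (dd L g lam TT lnn cn K kap rho : R) :
  1 <= dd -> 1 <= L -> 1 <= g -> 0 < lam -> 0 < TT -> 1 <= lnn -> 1 <= kap ->
  Num.sqrt lam <= rho -> 0 < K -> 0 <= cn -> lam <= cn * TT -> 256 * K ^+ 2 <= lam * g ->
  8 * Num.sqrt (8 * (dd * L / (TT * g))) + 2 * (K / Num.sqrt g) ^+ 2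
   + 32 * Num.sqrt dd * ((K / Num.sqrt g) ^+ 2 / lam)
   + 8 * ((K / Num.sqrt g) ^+ 2 / Num.sqrt lam) <=
  (8 * Num.sqrt (8 * cn) + 10 * K ^+ 2 + 2 * K) * Num.sqrt (dd * L / (g * lam)) *
  (1 + kap * (kap * Num.sqrt (lnn / g) + Num.sqrt TT^-1) * rho).
Proof.
move=> dd1 L1 g1 lam0 TT0 lnn1 kap1 hrho K0 cn0 lamT hK.
have g0 : 0 < g by lra.
have dd0 : 0 < dd by lra.
have L0 : 0 < L by lra.
have ln0 : 0 < lnn by lra.
have kap0 : 0 < kap by lra.
have dL0 : 0 < dd * L by rewrite mulr_gt0.
have dL1 : 1 <= dd * L by rewrite mulr_ege1.
have gl0 : 0 < g * lam by rewrite mulr_gt0.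
rewrite expr_div_n (sqr_sqrtr (ltW g0)).
set tau := Num.sqrt (dd * L / (g * lam)).
set br := (1 + _).
have tau0 : 0 <= tau by exact: sqrtr_ge0.
have rho0 : 0 <= rho by apply: le_trans hrho; exact: sqrtr_ge0.
have s0 : 0 <= Num.sqrt TT^-1 by exact: sqrtr_ge0.
have z0 : 0 <= Num.sqrt (lnn / g) by exact: sqrtr_ge0.
have br1 : 1 <= br by rewrite /br lerDl mulr_ge0// mulr_ge0 ?(ltW kap0)// addr_ge0//
  mulr_ge0// ltW.
have brz : Num.sqrt (lnn / g) * Num.sqrt lam <= br.
  apply: (@le_trans _ _ (kap * (kap * Num.sqrt (lnn / g) + Num.sqrt TT^-1) * rho)); last first.
    by rewrite /br lerDr.
  apply: ler_pM => //.
  have : Num.sqrt (lnn / g) <= kap * Num.sqrt (lnn / g) by rewrite ler_peMl.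
  move=> h1; have h2 : kap * Num.sqrt (lnn / g) + Num.sqrt TT^-1 <=
    kap * (kap * Num.sqrt (lnn / g) + Num.sqrt TT^-1).
    by rewrite ler_peMl//; lra.
  lra.
have tau_br : tau <= tau * br by rewrite ler_peMr.
have e1 : Num.sqrt (8 * (dd * L / (TT * g))) <= Num.sqrt (8 * cn) * (tau * br).
  apply: (@le_trans _ _ (Num.sqrt (8 * cn) * tau)); last by rewrite ler_wpM2l// sqrtr_ge0.
  rewrite -sqrtrM ?mulr_ge0// ler_wsqrtr// -!mulrA ler_pM2l//.
  have -> : dd * (L * (TT * g)^-1) = dd * L / (g * lam) * (lam / TT) by field; rewrite !gt_eqF.
  rewrite [leRHS](_ : _ = dd * L / (g * lam) * cn); last by field; rewrite !gt_eqF.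
  by rewrite ler_pM2l ?divr_gt0// ler_pdivrMr.
(* Only the part [sqrt (lnn / g) * sqrt lam] of the bracket is kept: [lam] cancels against [tau],
   leaving [sqrt (dd L lnn) / g]. *)
have e2 : g^-1 <= tau * br.
  apply: le_trans (ler_wpM2l tau0 brz).
  rewrite -sqrtrM ?(divr_ge0 (ltW ln0) (ltW g0))// -sqrtrM ?(divr_ge0 (ltW dL0) (ltW gl0))//.
  have -> : dd * L / (g * lam) * (lnn / g * lam) = dd * L * lnn * (g^-1) ^+ 2.
    by field; rewrite !gt_eqF.
  have h0 : 0 <= dd * L * lnn by rewrite ltW// mulr_gt0.
  rewrite (sqrtrM _ h0) sqrtr_sqr ger0_norm ?invr_ge0 ?(ltW g0)//.
  rewrite ler_peMl ?invr_ge0 ?(ltW g0)// -[leLHS]sqrtr1 ler_wsqrtr//.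
  by rewrite mulr_ege1.
have y0 : 0 < Num.sqrt (g * lam) by rewrite sqrtr_gt0.
have y2 : Num.sqrt (g * lam) ^+ 2 = g * lam by rewrite sqr_sqrtr// (ltW gl0).
have yK : 16 * K <= Num.sqrt (g * lam).
  rewrite -[leLHS]ger0_norm ?mulr_ge0 ?(ltW K0)// -sqrtr_sqr ler_wsqrtr// exprMn.
  by rewrite [g * lam]mulrC; lra.
have tauE : tau = Num.sqrt (dd * L) / Num.sqrt (g * lam).
  by rewrite /tau sqrtrM ?(ltW dL0)// sqrtrV// (ltW gl0).
(* One of the two factors [1 / sqrt (g lam)] is traded for a constant by [16 K <= sqrt (g lam)]; the
   other stays in [tau]. *)
have e3 : 32 * Num.sqrt dd * (K ^+ 2 / g / lam) <= 2 * K * (tau * br).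
  apply: (@le_trans _ _ (2 * K * tau)); last first.
    by rewrite ler_wpM2l// mulr_ge0// ltW.
  have -> : 32 * Num.sqrt dd * (K ^+ 2 / g / lam) = 2 * K * (Num.sqrt dd * (16 * K / (g * lam))).
    by field; rewrite !gt_eqF.
  rewrite ler_wpM2l ?mulr_ge0 ?(ltW K0)// tauE.
  apply: ler_pM; rewrite ?sqrtr_ge0 ?divr_ge0 ?mulr_ge0 ?(ltW K0) ?(ltW g0) ?(ltW lam0)//.
    by rewrite ler_wsqrtr// ler_peMr// (ltW dd0).
  move: (Num.sqrt (g * lam)) y0 y2 yK => y y0 y2 yK.
  by rewrite ler_pdivrMr// -y2 expr2 mulKf ?gt_eqF.
have e4 : g^-1 / Num.sqrt lam <= tau * br.
  apply: le_trans tau_br; rewrite tauE.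
  have sl0 : 0 < Num.sqrt lam by rewrite sqrtr_gt0.
  have sg0 : 0 < Num.sqrt g by rewrite sqrtr_gt0.
  rewrite [Num.sqrt (g * lam)]sqrtrM ?(ltW g0)// -invfM -[leLHS]mul1r.
  apply: ler_pM; rewrite ?invr_ge0 ?mulr_ge0 ?(ltW g0) ?(ltW sl0)//.
    by rewrite -[leLHS]sqrtr1 ler_wsqrtr.
  rewrite lef_pV2 ?posrE ?mulr_gt0// ler_pM2r//.
  have h : 1 <= Num.sqrt g by rewrite -[leLHS]sqrtr1 ler_wsqrtr.
  by rewrite -[leRHS](sqr_sqrtr (ltW g0)) expr2 ler_peMl ?(ltW sg0).
have K20 : 0 <= K ^+ 2 by exact: sqr_ge0.
have e2' := ler_wpM2l K20 e2.
have e4' : K ^+ 2 / g / Num.sqrt lam <= K ^+ 2 * (tau * br).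
  by rewrite -mulrA; exact: ler_wpM2l.
rewrite -[leRHS]mulrA; lra.
Qed.

Lemma minf_le m (f : 'I_m -> R) i : minf f <= f i.
Proof. exact: bigmin_le. Qed.

Lemma le_maxf m (f : 'I_m -> R) i : f i <= maxf f.
Proof. exact: le_bigmax. Qed.

Lemma minf_gt0 m (f : 'I_m -> R) : (0 < m)%N -> (forall i, 0 < f i) -> 0 < minf f.
Proof.
move=> m0 f0; apply: lt_bigmin => [|i _] //.
exact: lt_le_trans (f0 (Ordinal m0)) (le_maxf _ _).
Qed.

Lemma kappa_ge1 m (f : 'I_m -> R) : (0 < m)%N -> 0 < minf f -> 1 <= kappa f.
Proof.
move=> m0 f0; rewrite /kappa ler_pdivlMr// mul1r.
exact: le_trans (minf_le f (Ordinal m0)) (le_maxf _ _).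
Qed.

Section Embedding.
Variables (n T d : nat) (A : 'M[R]_(n, T)) (Us : 'M[R]_(n, d)) (ls : 'I_d -> R).
Hypotheses (hA : is_nonzero_eigdecomp (A *m A^T) Us ls) (rA : forall i, enorm (row i A) = 1).

Lemma eigdecomp_rank_gt0 : (0 < n)%N -> (0 < d)%N.
Proof.
move=> n0; rewrite lt0n; apply/eqP => d0.
have := row_embed_enorm hA (rA (Ordinal n0)); rewrite /enorm dotrr_sum big1 ?sqrtr0.
  by move/esym/eqP; rewrite oner_eq0.
by move=> j _; exfalso; move: (ltn_ord j); rewrite [X in (_ < X)%N]d0.
Qed.

Lemma embed_row_sum i : \sum_j Us i j ^+ 2 * ls j = 1.
Proof.
have [_ _ lp _] := hA.
have := enorm_sqr (row i (sqrt_embed Us ls)); rewrite (row_embed_enorm hA)// expr1n => ->.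
rewrite dotrr_sum; apply: eq_bigr => j _.
by rewrite /sqrt_embed mul_mx_diag !mxE exprMn sqr_sqrtr// ltW.
Qed.

(** A trace argument: the correlation matrix has unit diagonal, so its eigenvalues sum to [n]. *)
Lemma eigenvalue_le j : ls j <= n%:R.
Proof.
have [oU _ lp _] := hA.
have -> : n%:R = \sum_(i < n) \sum_j Us i j ^+ 2 * ls j.
  by rewrite (eq_bigr (fun=> 1)) ?sumr_const ?card_ord// => i _; rewrite embed_row_sum.
have -> : ls j = \sum_i Us i j ^+ 2 * ls j.
  rewrite -mulr_suml -[LHS]mul1r; congr (_ * _).
  have /matrixP/(_ j j) := oU; rewrite [RHS]mxE eqxx mulr1n mxE => <-.
  by apply: eq_bigr => i _; rewrite !mxE expr2.
apply: ler_sum => i _; rewrite [leRHS](bigD1 j)//= lerDl; apply: sumr_ge0 => k _.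
by rewrite mulr_ge0 ?sqr_ge0// ltW.
Qed.

Lemma norm2inf_ge lam : (0 < n)%N -> 0 <= lam -> (forall j, lam <= ls j) ->
  Num.sqrt lam <= norm2inf (A *m A^T).
Proof.
move=> n0 lam0 hlam; have [oU _ lp eA] := hA; pose i := Ordinal n0.
apply: (@le_trans _ _ (enorm (row i (A *m A^T)))); last first.
  rewrite /norm2inf; apply: le_trans (le_bigmax _ _ i).
  rewrite /enorm dotrr_sum le_eqVlt; apply/orP; left; apply/eqP; congr Num.sqrt.
  by apply: eq_bigr => j _; rewrite mxE.
(* The squared row norm is the sum of [Us i j ^+ 2 * ls j ^+ 2], at least [lam] times the unit sum
   of [embed_row_sum]. *)
rewrite eA row_mul enorm_iso ?trmxK// /enorm ler_wsqrtr// dotrr_sum.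
rewrite -[lam]mulr1 -(embed_row_sum i) mulr_sumr; apply: ler_sum => j _.
rewrite mul_mx_diag !mxE exprMn mulrCA expr2 [ls j ^+ 2]expr2 ler_wpM2l ?sqr_ge0//.
by rewrite ler_wpM2r// ltW.
Qed.

End Embedding.

End FixedIndex.

Lemma ln4_ge1 (R : realType) (m : nat) : (4 <= m)%N -> 1 <= ln (m%:R : R).
Proof.
move=> m4.
have h : expR (1 / 2) <= 2 :> R.
  have := expR_ge1Dx (- (1 / 2) : R); rewrite expRN => h.
  rewrite -[leLHS]invrK -[leRHS]invrK lef_pV2 ?posrE ?invr_gt0 ?expR_gt0//; lra.
have h4 : expR 1 <= 4 :> R.
  have -> : 1 = 1 / 2 + 1 / 2 :> R by lra.
  by rewrite expRD; have := expR_gt0 (1 / 2 : R); nra.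
have m0 : (0 : R) < m%:R by rewrite ltr0n (leq_trans _ m4).
rewrite -ler_expR lnK ?posrE// (le_trans h4)//.
by rewrite ler_nat.
Qed.

(** The condition on [K] makes the net contribution at most [exp (- T) <= 1 / T]. The entrywise one
    is [2 n d / T^4], with [n] and [d] both at most [cn T]. *)
Lemma failure_prob_le (R : realType) (n T d : nat) (cn K : R) :
  (0 < T)%N -> (d <= n)%N -> n%:R <= cn * T%:R ->
  32 * (ln 64 * (1 + cn) + 1) <= K ^+ 2 ->
  64 ^+ n * 64 ^+ T * expR (- (K ^+ 2 * T%:R / 32))
    + 2 * (n%:R * d%:R) * expR (- (4 * ln T%:R)) <= (1 + 2 * cn ^+ 2) / T%:R.
Proof.
move=> T0 dn nT hK; have TR : 0 < T%:R :> R by rewrite ltr0n.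
have T1 : 1 <= T%:R :> R by rewrite ler1n.
have cn0 : 0 <= cn by rewrite -(pmulr_lge0 _ TR) (le_trans _ nT).
have l64 : 0 <= ln 64 :> R by rewrite ln_ge0//; lra.
rewrite [leRHS]mulrDl; apply: lerD.
  have e64 k : 64 ^+ k = expR (k%:R * ln 64) :> R.
    by rewrite expRM_natl lnK// posrE.
  rewrite !e64 -!expRD -[1 / _]expr1 div1r expr1.
  apply: (@le_trans _ _ (expR (- T%:R))).
    rewrite ler_expR.
    have h1 := ler_wpM2r l64 nT.
    have h2 := ler_wpM2r (ltW TR) hK.
    lra.
  rewrite expRN lef_pV2 ?posrE ?expR_gt0//.
  by apply: le_trans (expR_ge1Dx _); rewrite lerDr.
rewrite expRN expRM_natl lnK ?posrE//.
rewrite -ler_pdivlMr ?invr_gt0 ?exprn_gt0// invrK.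
have -> : 2 * cn ^+ 2 / T%:R * T%:R ^+ 4 = 2 * ((cn * T%:R) * (cn * T%:R)) * T%:R.
  by field; rewrite gt_eqF.
apply: (@le_trans _ _ (2 * ((cn * T%:R) * (cn * T%:R)))); last first.
  by rewrite ler_peMr// !mulr_ge0// ltW.
rewrite ler_wpM2l//; apply: ler_pM => //.
by apply: le_trans nT; rewrite ler_nat.
Qed.

(** The smallness conditions on [e] translate, via [1 / g <= L / g <= e], into [a <= 1/16] (as
    [a^2 <= 8 cn e]), [b^2 <= 1/8] and [(16 b)^2 <= lam], which are the requirements of the
    deterministic perturbation bound. *)
Lemma fixed_index_bound dsp (Om : measurableType dsp) (R : realType) (P : probability Om R)
  (n T d : nat) (Zs : 'M[R]_(n, T)) (N : Om -> 'M[R]_(n, T)) (nu : 'I_n -> R)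
  (Us : 'M[R]_(n, d)) (ls : 'I_d -> R) (cn c K e : R) :
  (4 <= n)%N -> (4 <= T)%N -> (forall i, 0 < sigma2 Zs i) ->
  is_nonzero_eigdecomp (corr Zs) Us ls -> noise_assumption P N nu ->
  1 <= cn -> n%:R <= cn * T%:R -> 0 < c -> c <= minf ls ->
  0 < K -> 32 * (ln 64 * (1 + cn) + 1) <= K ^+ 2 ->
  0 < e -> e <= 1 -> 2048 * cn * e <= 1 -> 8 * K ^+ 2 * e <= 1 -> 256 * K ^+ 2 * e <= c ->
  kappa ls * ln T%:R / gamma Zs nu <= e ->
  exists E : set Om, [/\ measurable E,
    ((1 - (1 + 2 * cn ^+ 2) / T%:R)%:E <= P E)%E &
    forall w, E w -> (forall i, 0 < sigma2 (Zs + N w) i) /\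
      forall (U : 'M[R]_(n, d)) (l : 'I_d -> R),
        is_top_eigpairs (corr (Zs + N w)) U l ->
        exists Q : 'M[R]_d, is_orthogonal_mx Q /\
          norm2inf (sqrt_embed U l - sqrt_embed Us ls *m Q) <=
          (8 * Num.sqrt (8 * cn) + 10 * K ^+ 2 + 2 * K) *
          Num.sqrt (d%:R * ln T%:R / (gamma Zs nu * minf ls)) *
          (1 + kappa ls * (kappa ls * Num.sqrt (ln n%:R / gamma Zs nu)
                           + Num.sqrt (T%:R)^-1) * norm2inf (corr Zs))].
Proof.
move=> n4 T4 sZ hU hN cn1 nT c0 clam K0 hK e0 e1 h1 h2 h3 hkap.
have n0 : (0 < n)%N by apply: leq_trans n4.
have T0 : (0 < T)%N by apply: leq_trans T4.
have TR : 0 < T%:R :> R by rewrite ltr0n.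
have L1 := ln4_ge1 R T4; have ln1 := ln4_ge1 R n4.
set L := ln T%:R in L1 hkap *.
set g := gamma Zs nu in hkap *.
set lam := minf ls in clam *.
set kap := kappa ls in hkap *.
have [_ _ _ nu0 _] := hN.
pose s := stddev Zs.
have s0 i : 0 < s i by rewrite /s /stddev sqrtr_gt0.
have s2 i : s i ^+ 2 = sigma2 Zs i by rewrite sqr_sqrtr// ltW.
pose A := scaled_center s Zs.
have rA i : enorm (row i A) = 1 by exact: enorm_row_standardized.
have eC : corr Zs = A *m A^T := corrE _ T0.
have hA : is_nonzero_eigdecomp (A *m A^T) Us ls by rewrite -eC.
have d0 := eigdecomp_rank_gt0 hA rA n0.
have dn : (d <= n)%N by have [oU _ _ _] := hA; exact: orthonormal_cols_le oU.
have lam0 : 0 < lam by apply: lt_le_trans clam.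
have hlam j : lam <= ls j by exact: minf_le.
have kap1 : 1 <= kap by exact: kappa_ge1.
have g0 : 0 < g by apply: minf_gt0 => // i; rewrite divr_gt0.
have hg i : g <= s i ^+ 2 / nu i by rewrite s2; exact: (minf_le (fun i => sigma2 Zs i / nu i)).
have L0 : 0 < L by lra.
have kL : L / g <= e.
  apply: le_trans hkap; rewrite -mulrA ler_peMl// divr_ge0// ltW//.
have gi : g^-1 <= e.
  by apply: le_trans kL; rewrite ler_peMl// invr_ge0 (ltW g0).
have g1 : 1 <= g by rewrite -[leLHS]invr1 -[leRHS]invrK lef_pV2 ?posrE ?invr_gt0//; lra.
have sg0 : 0 < Num.sqrt g by rewrite sqrtr_gt0.
pose Y := right_factor A Us ls.
have [E [mE PE hE]] := noise_event hN n0 T0 s0 g0 hg K0 L0 (right_factor_ortho hA).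
exists E; split=> //.
  apply: le_trans PE; rewrite lee_fin lerD2l lerN2.
  exact: failure_prob_le.
move=> w /hE[oW hWY].
pose b := K / Num.sqrt g; pose a := Num.sqrt (8 * (d%:R * L / (T%:R * g))).
have a0 : 0 <= a by exact: sqrtr_ge0.
have b0 : 0 <= b by rewrite divr_ge0// ltW.
have b2 : b ^+ 2 = K ^+ 2 * g^-1 by rewrite expr_div_n sqr_sqrtr// ltW.
have K20 : 0 <= K ^+ 2 by exact: sqr_ge0.
have Kg := ler_wpM2l K20 gi.
have blam : 16 * b <= Num.sqrt lam.
  have -> : 16 * b = Num.sqrt ((16 * b) ^+ 2) by rewrite sqrtr_sqr ger0_norm// mulr_ge0.
  rewrite ler_wsqrtr// exprMn b2; lra.
have a16 : a <= 1 / 16.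
  have -> : 1 / 16 = Num.sqrt ((1 / 16) ^+ 2) :> R by rewrite sqrtr_sqr ger0_norm.
  rewrite ler_wsqrtr//.
  have : d%:R * L / (T%:R * g) <= cn * (L / g).
    have -> : d%:R * L / (T%:R * g) = (d%:R / T%:R) * (L / g) by field; rewrite !gt_eqF.
    rewrite ler_wpM2r ?divr_ge0 ?(ltW L0) ?(ltW g0)// ler_pdivrMr//.
    by apply: le_trans nT; rewrite ler_nat.
  have cn0 : 0 <= cn by lra.
  have := ler_wpM2l cn0 kL; lra.
have ab : 2 * a + b ^+ 2 <= 1 / 4 by rewrite b2; lra.
have [AW0 hemb] := embedding_perturbation hA rA lam0 hlam a0 b0 blam ab oW hWY.
rewrite -scaled_centerD in AW0 hemb.
split=> [i|U l].
  have := AW0 i; rewrite enorm_row_scaled_center; last exact: ltW.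
  by rewrite pmulr_rgt0 ?invr_gt0// /stddev sqrtr_gt0.
rewrite (corr_normalize _ T0 s0) => /hemb[Q [oQ hQ]].
exists Q; split=> //; apply: le_trans hQ _.
apply: rate_bound => //.
- by rewrite ler1n.
- by rewrite eC; apply: norm2inf_ge hA rA _ n0 (ltW lam0) hlam.
- lra.
- by apply: le_trans nT; apply: le_trans (hlam (Ordinal d0)) (eigenvalue_le hA rA _).
- rewrite -ler_pdivrMr//; lra.
Qed.

Lemma exists_sqrt_ge (R : rcfType) (x : R) : exists2 K : R, 0 < K & x <= K ^+ 2.
Proof.
exists (Num.sqrt (Num.max x 1)); first by rewrite sqrtr_gt0 lt_max ltr01 orbT.
by rewrite sqr_sqrtr ?le_max ?lexx// ler01 orbT.
Qed.

Lemma exists_scaling (R : realFieldType) (x y z c : R) : 0 <= x -> 0 <= y -> 0 <= z -> 0 < c ->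
  exists e : R, [/\ 0 < e, e <= 1, x * e <= 1, y * e <= 1 & z * e <= c].
Proof.
move=> x0 y0 z0 c0; pose D := 1 + x + y + z.
have D0 : 0 < D by rewrite /D; lra.
have m0 : 0 < Num.min 1 c by rewrite lt_min ltr01.
have m1 : Num.min 1 c <= 1 by rewrite ge_min lexx.
have mc : Num.min 1 c <= c by rewrite ge_min lexx orbT.
have le t u : 0 <= t -> t <= D -> Num.min 1 c <= u -> t * (Num.min 1 c / D) <= u.
  move=> t0 tD; apply: le_trans; rewrite mulrCA ler_piMr ?(ltW m0)//.
  by rewrite ler_pdivrMr// mul1r.
exists (Num.min 1 c / D); split; [exact: divr_gt0| |by apply: le; rewrite // /D; lra..].
by rewrite -[leLHS]mul1r; apply: le; rewrite // /D; lra.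
Qed.

(** The events are fixed before the eigenvectors, so the estimate is uniform over all choices of top
    eigenpairs and no measurable selection is involved. *)
Theorem mainTheorem1 (R : realType)
  (dsp : nat -> measure_display) (Om : forall k, measurableType (dsp k))
  (P : forall k, probability (Om k) R)
  (n T d : nat -> nat)
  (Zs : forall k, 'M[R]_(n k, T k))
  (N : forall k, Om k -> 'M[R]_(n k, T k))
  (nu : forall k, 'I_(n k) -> R)
  (Us : forall k, 'M[R]_(n k, d k))
  (ls : forall k, 'I_(d k) -> R) :
  tends_to_infty n -> tends_to_infty T ->
  (forall k i, 0 < sigma2 (Zs k) i) ->
  (* R* = U* Lambda* U*^T, d = rank R*, Lambda* = diag of nonzero eigenvalues *)
  (forall k, is_nonzero_eigdecomp (corr (Zs k)) (Us k) (ls k)) ->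
  (* Assumption 1 *)
  (forall k, noise_assumption (P k) (N k) (nu k)) ->
  (exists c : R, \forall k \near \oo, (n k)%:R <= c * (T k)%:R) ->
  (* Assumption 2 *)
  (exists c : R, 0 < c /\ \forall k \near \oo, c <= minf (ls k)) ->
  ((fun k => kappa (ls k) / (T k)%:R) @ \oo --> (0 : R)) ->
  ((fun k => kappa (ls k) * ln (T k)%:R / gamma (Zs k) (nu k)) @ \oo --> (0 : R)) ->
  exists C : R, 0 < C /\
  exists E : forall k, set (Om k),
    (forall k, measurable (E k)) /\
    (forall eps : R, 0 < eps ->
       \forall k \near \oo, ((1 - eps)%:E <= P k (E k))%E) /\
    (forall k w, E k w ->
       let Z := Zs k + N k w in
       (forall i, 0 < sigma2 Z i) /\
       forall (U : 'M[R]_(n k, d k)) (l : 'I_(d k) -> R),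
         is_top_eigpairs (corr Z) U l ->
         exists Q : 'M[R]_(d k), is_orthogonal_mx Q /\
           norm2inf (sqrt_embed U l - sqrt_embed (Us k) (ls k) *m Q)
           <= C * Num.sqrt ((d k)%:R * ln (T k)%:R
                            / (gamma (Zs k) (nu k) * minf (ls k)))
                * (1 + kappa (ls k)
                       * (kappa (ls k)
                            * Num.sqrt (ln (n k)%:R / gamma (Zs k) (nu k))
                          + Num.sqrt ((T k)%:R^-1))
                       * norm2inf (corr (Zs k)))).
Proof.
move=> ninf Tinf hs hU hN [c1 hc1] [c [c0 hc]] _ hk.
have [cn [cn1 c1n]] : exists cn : R, 1 <= cn /\ c1 <= cn.
  by exists (Num.max c1 1); rewrite !le_max !lexx orbT.
have [K K0 hK] := exists_sqrt_ge (32 * (ln 64 * (1 + cn) + 1)).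
have K20 : 0 <= K ^+ 2 by exact: sqr_ge0.
have cn0 : 0 <= 2048 * cn := mulr_ge0 (ler0n R 2048) (le_trans ler01 cn1).
have [e [e0 e1 e2 e3 e4]] :=
  exists_scaling cn0 (mulr_ge0 (ler0n R 8) K20) (mulr_ge0 (ler0n R 256) K20) c0.
pose good k := [/\ (4 <= n k)%N, (4 <= T k)%N, (n k)%:R <= cn * (T k)%:R,
  c <= minf (ls k) & kappa (ls k) * ln (T k)%:R / gamma (Zs k) (nu k) <= e].
have hgood : \forall k \near \oo, good k.
  have [N1 hN1] := ninf 4%N; have [N2 hN2] := Tinf 4%N.
  near=> k; split.
  - by apply: hN1; near: k; exact: nbhs_infty_ge.
  - by apply: hN2; near: k; exact: nbhs_infty_ge.
  - apply: (@le_trans _ _ (c1 * (T k)%:R)); first by near: k.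
    by rewrite ler_wpM2r.
  - by near: k.
  - apply: le_trans (ler_norm _) _; rewrite -[X in `|X|]subr0 distrC.
    by near: k; move/cvgrPdist_le : hk; apply.
pose C := 8 * Num.sqrt (8 * cn) + 10 * K ^+ 2 + 2 * K.
exists C; split.
  rewrite /C; apply: ltr_wpDl; last by rewrite mulr_gt0.
  by apply: addr_ge0; apply: mulr_ge0; rewrite ?sqrtr_ge0.
(* For the finitely many indices that are not [good] the event is empty: the estimate is then
   vacuous, and the probability is constrained only eventually. *)
have ev k : exists E : set (Om k), measurable E /\
    (good k -> ((1 - (1 + 2 * cn ^+ 2) / (T k)%:R)%:E <= P k E)%E) /\
    (forall w, E w -> (forall i, 0 < sigma2 (Zs k + N k w) i) /\
      forall (U : 'M[R]_(n k, d k)) (l : 'I_(d k) -> R),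
        is_top_eigpairs (corr (Zs k + N k w)) U l ->
        exists Q : 'M[R]_(d k), is_orthogonal_mx Q /\
          norm2inf (sqrt_embed U l - sqrt_embed (Us k) (ls k) *m Q) <=
          C * Num.sqrt ((d k)%:R * ln (T k)%:R / (gamma (Zs k) (nu k) * minf (ls k))) *
          (1 + kappa (ls k) * (kappa (ls k) * Num.sqrt (ln (n k)%:R / gamma (Zs k) (nu k))
                           + Num.sqrt ((T k)%:R^-1)) * norm2inf (corr (Zs k)))).
  have [[n4 T4 nT clam kL]|ng] := pselect (good k); last first.
    by exists set0; split; [exact: measurable0|split=> [/ng//|w []]].
  have [E [mE PE hE]] := fixed_index_bound n4 T4 (hs k) (hU k) (hN k) cn1 nT c0 clam K0 hK
    e0 e1 e2 e3 e4 kL.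
  by exists E.
exists (fun k => sval (cid (ev k))); split; [|split].
- by move=> k; case: (proj2_sig (cid (ev k))).
- move=> eps eps0.
  have [M hM] : exists M : nat, (1 + 2 * cn ^+ 2) / eps <= M%:R.
    exists (Num.truncn ((1 + 2 * cn ^+ 2) / eps)).+1.
    exact/ltW/truncnS_gt.
  have [N1 hN1] := Tinf M.+1.
  near=> k.
  have gk : good k by near: k.
  have Tk : (M.+1 <= T k)%N by apply: hN1; near: k; exact: nbhs_infty_ge.
  case: (proj2_sig (cid (ev k))) => _ [/(_ gk) h _]; apply: le_trans h.
  have TR : 0 < (T k)%:R :> R by rewrite ltr0n (leq_trans _ Tk).
  rewrite lee_fin lerD2l lerN2 ler_pdivrMr// [leRHS]mulrC -ler_pdivrMr//.
  by rewrite (le_trans hM)// ler_nat ltnW.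
- move=> k w Ew; case: (proj2_sig (cid (ev k))) => _ [_ h].
  exact: h.
Unshelve. all: by end_near.
Qed.
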